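(* Let $\mathcal{G}$ be an acyclic directed mixed graph with vertex set $V$. The model $\mathcal{P}_{\mathcal{G}}$ of strictly positive binary probability distributions satisfying the global Markov property with respect to $\mathcal{G}$ is smoothly parameterized by $\mathbf{q}\in\mathcal{Q}_{\mathcal{G}}$. Consequently, the model $\mathcal{P}_{\mathcal{G}}$ is a curved exponential family of dimension $$d=\sum_{H\in\mathcal{H}(\mathcal{G})}|\mathfrak{X}_{\operatorname{tail}(H)}|=\sum_{H\in\mathcal{H}(\mathcal{G})}2^{|\operatorname{tail}_{\mathcal{G}}(H)|}.$$
   Context: **Graphs.** An acyclic directed mixed graph (ADMG) $\mathcal{G}$ consists of a finite vertex set $V$, a set of directed edges $v\to w$ ($v\neq w$) with no directed cycles, and a set of bidirected edges $v\leftrightarrow w$ (unordered pairs of distinct vertices); a pair may be joined by both a directed and a bidirected edge. For $A\subseteq V$, $\mathcal{G}_A$ is the induced subgraph on $A$. A path is a sequence of adjacent edges without repetition of a vertex (possibly empty). $\operatorname{pa}_{\mathcal{G}}(v)=\{w: w\to v\}$; $\operatorname{an}_{\mathcal{G}}(v)$ is the set of $w$ with a (possibly empty) directed path from $w$ to $v$, so $v\in\operatorname{an}_{\mathcal{G}}(v)$; $\operatorname{de}_{\mathcal{G}}(v)=\{w: v\in\operatorname{an}_{\mathcal{G}}(w)\}$; the district $\operatorname{dis}_{\mathcal{G}}(v)$ is the set of vertices joined to $v$ by a path consisting only of bidirected edges, including $v$. These are applied to sets by taking unions. $\operatorname{dis}_A$ means $\operatorname{dis}_{\mathcal{G}_A}$.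 $\operatorname{barren}_{\mathcal{G}}(B)=\{v\in B:\operatorname{de}_{\mathcal{G}}(v)\cap B=\{v\}\}$, and $B$ is barren if $B=\operatorname{barren}_{\mathcal{G}}(B)$. **Heads and tails.** A (nonempty) set $H\subseteq V$ is a head if it is barren and is contained within a single district of $\mathcal{G}_{\operatorname{an}(H)}$; $\mathcal{H}(\mathcal{G})$ is the collection of heads. The tail of $H$ is $T=\operatorname{tail}_{\mathcal{G}}(H)=(\operatorname{dis}_{\operatorname{an}(H)}(H)\setminus H)\cup\operatorname{pa}_{\mathcal{G}}(\operatorname{dis}_{\operatorname{an}(H)}(H))$. **Markov property.** A non-endpoint vertex on a path is a collider if both adjacent edges on the path have an arrowhead at it, and otherwise a non-collider. A path between $v,w$ is blocked by $C\subseteq V\setminus\{v,w\}$ if some non-collider on it is in $C$, or some collider on it is not in $\operatorname{an}_{\mathcal{G}}(C)$. Disjoint sets $A,B$ are m-separated given $C\subseteq V\setminus(A\cup B)$ if for all $a\in A$, $b\in B$ every path from $a$ to $b$ is blocked by $C$. A distribution satisfies the global Markov property for $\mathcal{G}$ if for all disjoint $A,B,C\subseteq V$ with $A,B$ nonempty, $A$ m-separated from $B$ given $C$ implies $X_A\perp\!\!\!\perp X_B\mid X_C$ ($C$ may be empty). **Model and parameters.** $\mathfrak{X}_A=\{0,1\}^A$. $\mathcal{P}_{\mathcal{G}}\subseteq\Delta_{2^{n}-1}$, $n=|V|$, is the set of strictly positive probability distributions $\mathbf{p}$ on $\{0,1\}^V$ obeying the global Markov property with respect to $\mathcal{G}$,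 where $\Delta_k$ is the strictly positive $k$-dimensional probability simplex. For $\mathbf{p}\in\mathcal{P}_{\mathcal{G}}$, $\mathbf{q}(\mathbf{p})\in\mathbb{R}^d$ is the vector with entries $q_H(x_T)=P(X_H=0\mid X_T=x_T)$, $H\in\mathcal{H}(\mathcal{G})$, $x_T\in\mathfrak{X}_T$, computed under $\mathbf{p}$; $\mathcal{Q}_{\mathcal{G}}=\mathbf{q}(\mathcal{P}_{\mathcal{G}})$. **Smooth parameterization, curved exponential family.** That $\mathcal{P}_{\mathcal{G}}$ is smoothly parameterized by $\mathbf{q}\in\mathcal{Q}_{\mathcal{G}}$ means: $\mathcal{Q}_{\mathcal{G}}$ is open in $\mathbb{R}^d$, the map $\mathbf{q}:\mathcal{P}_{\mathcal{G}}\to\mathcal{Q}_{\mathcal{G}}$ is a bijection which is smooth (infinitely differentiable), and its inverse $\mathcal{Q}_{\mathcal{G}}\to\mathcal{P}_{\mathcal{G}}\subseteq\Delta_{2^n-1}$ is smooth with Jacobian of full rank $d$ everywhere. A curved exponential family of dimension $d$ is (standard definition) a subfamily of a regular full exponential family (here the family $\Delta_{2^n-1}$ of all strictly positive distributions on $\{0,1\}^V$) whose set of natural parameters is a $d$-dimensional smooth embedded submanifold of the natural parameter space. *)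

(* Defs.v *)
From HB Require Import structures.
From mathcomp Require Import all_boot all_order all_algebra.
From mathcomp Require Import all_classical all_reals all_analysis.

Set Implicit Arguments.
Unset Strict Implicit.
Unset Printing Implicit Defensive.

Import Order.TTheory GRing.Theory Num.Theory.
Import numFieldNormedType.Exports.

Local Open Scope set_scope.
Local Open Scope ring_scope.

(* A self-loop and a pair of opposite directed edges are directed cycles, so
   [dir_acyclic] also excludes them. *)
Record admg (V : finType) := Admg {
  dir : rel V;
  bidir : rel V;
  dir_acyclic : forall c : seq V, cycle dir c -> c = [::];
  bidir_irr : irreflexive bidir;
  bidir_sym : symmetric bidir }.

Section Graph.
Variables (V : finType) (G : admg V).
Implicit Types (A B C H : {set V}) (v w : V).

Definition pa B : {set V} := [set w | [exists v in B, dir G w v]].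
Definition an B : {set V} := [set w | [exists v in B, connect (dir G) w v]].
Definition de B : {set V} := [set w | [exists v in B, connect (dir G) v w]].

Definition induced_bidir A : rel V :=
  [rel v w | [&& v \in A, w \in A & bidir G v w]].

(* [dis A B] is the district of [B] in the induced subgraph on [A]. *)
Definition dis A B : {set V} :=
  [set w in A | [exists v in A :&: B, connect (induced_bidir A) v w]].

Definition barren B : {set V} := [set v in B | de [set v] :&: B == [set v]].

Definition is_head H : bool :=
  [&& H != finset.set0, barren H == H
    & [exists v in an H, H \subset dis (an H) [set v]]].

Definition heads : {set {set V}} := [set H | is_head H].

Definition tail H : {set V} :=
  (dis (an H) H :\: H) :|: pa (dis (an H) H).

(* The edge between two consecutive vertices [x], [y] of a path is given by its
   marks [(a, b)]: [a] (resp. [b]) tells whether it has an arrowhead at [x]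
   (resp. at [y]).  Two vertices may be joined by several edges, so a path from
   [x] lists the edge taken together with each further vertex. *)
Definition edge x (a b : bool) y : bool :=
  match a, b with
  | false, true => dir G x y
  | true, false => dir G y x
  | true, true => bidir G x y
  | false, false => false
  end.

Definition step : Type := ((bool * bool) * V)%type.

Fixpoint walk x (s : seq step) : bool :=
  if s is ((a, b), y) :: s' then edge x a b y && walk y s' else true.

Definition vertices x (s : seq step) : seq V := x :: [seq e.2 | e <- s].

Definition gpath x y (s : seq step) : bool :=
  [&& walk x s, uniq (vertices x s) & last x [seq e.2 | e <- s] == y].

(* [b && a'] says that the intermediate vertex [y] is a collider. *)
Fixpoint blocked C (s : seq step) : bool :=
  if s is ((_, b), y) :: s' then
    if s' is ((a', _), _) :: _ then
      (if b && a' then y \notin an C else y \in C) || blocked C s'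
    else false
  else false.

Definition msep A B C : Prop :=
  forall a b, a \in A -> b \in B ->
  forall s, gpath a b s -> blocked C s.

End Graph.

Definition config (V : finType) (A : {set V}) : Type :=
  {ffun {v : V | v \in A} -> bool}.
HB.instance Definition _ V A := Finite.on (@config V A).

Definition states (V : finType) : Type := {ffun V -> bool}.
HB.instance Definition _ V := Finite.on (states V).

Section Distribution.
Variables (R : realType) (V : finType).
Implicit Types (p : 'rV[R]_#|{: states V}|) (E F : pred (states V)).

Definition mass p (x : states V) : R := p 0 (enum_rank x).

Definition prob p E : R := \sum_(x | E x) mass p x.

Definition cprob p E F : R := prob p [predI E & F] / prob p F.

Definition ev (A : {set V}) (xA : config A) : pred (states V) :=
  [pred x : states V | [forall v : {v | v \in A}, x (val v) == xA v]].

Definition cond_indep p (A B C : {set V}) : Prop :=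
  forall (xA : config A) (xB : config B) (xC : config C),
    cprob p [predI ev xA & ev xB] (ev xC) =
    cprob p (ev xA) (ev xC) * cprob p (ev xB) (ev xC).

Definition pos_distribution p : Prop :=
  (forall x, 0 < mass p x) /\ \sum_x mass p x = 1.

Definition global_markov (G : admg V) p : Prop :=
  forall A B C : {set V},
    [disjoint A & B] -> [disjoint A & C] -> [disjoint B & C] ->
    A != finset.set0 -> B != finset.set0 ->
    msep G A B C -> cond_indep p A B C.

Definition model (G : admg V) : set 'rV[R]_#|{: states V}| :=
  [set p | pos_distribution p /\ global_markov G p]%classic.

Definition head (G : admg V) : Type := {H : {set V} | H \in heads G}.
HB.instance Definition _ G := Finite.on (head G).

Definition param_index (G : admg V) : Type :=
  {H : head G & config (tail G (val H))}.
HB.instance Definition _ G := Finite.on (param_index G).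

Definition zero_config (A : {set V}) : config A := [ffun=> false].

Definition qmap (G : admg V) p : 'rV[R]_#|{: param_index G}| :=
  \row_i let: existT H xT := enum_val i in
         cprob p (ev (zero_config (val H))) (ev xT).

End Distribution.

Arguments model R {V} G _.
Arguments qmap R {V} G p.

Local Open Scope classical_set_scope.

Section Smooth.
Variable R : realType.

(* Meaningful for open [U]. *)
Fixpoint Ck (k : nat) m n (U : set 'rV[R]_m) (f : 'rV[R]_m -> 'rV[R]_n) : Prop :=
  if k is k'.+1 then
    (forall x, U x -> differentiable f x) /\
    (forall v, Ck k' U (fun x => 'D_v f x))
  else forall x, U x -> {for x, continuous f}.

Definition smooth m n (U : set 'rV[R]_m) (f : 'rV[R]_m -> 'rV[R]_n) : Prop :=
  forall k, Ck k U f.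

(* Smoothness on a subset that need not be open: near each of its points the
   map has a smooth extension to an open set of the ambient space. *)
Definition smooth_within m n (A : set 'rV[R]_m) (f : 'rV[R]_m -> 'rV[R]_n) :=
  forall x, A x -> exists (U : set 'rV[R]_m) (g : 'rV[R]_m -> 'rV[R]_n),
    [/\ open U, U x, smooth U g & forall y, U y -> A y -> g y = f y].

Definition smoothly_parameterized N d
    (P : set 'rV[R]_N) (q : 'rV[R]_N -> 'rV[R]_d) : Prop :=
  let Q := q @` P in
  [/\ open Q, set_bij P Q q, smooth_within P q &
      exists g : 'rV[R]_d -> 'rV[R]_N,
        [/\ forall y, Q y -> P (g y) /\ q (g y) = y,
            smooth Q g &
            forall y, Q y -> \rank ('J g y) = d]].

Definition diffeomorphism N (U W : set 'rV[R]_N) (f : 'rV[R]_N -> 'rV[R]_N) :=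
  [/\ open U, open W, set_bij U W f, smooth U f &
      exists2 g : 'rV[R]_N -> 'rV[R]_N,
        forall x, U x -> g (f x) = x & smooth W g].

Definition coord_slice N d : set 'rV[R]_N :=
  [set y | forall i : 'I_N, (d <= i)%N -> y 0 i = 0].

Definition embedded_submanifold N (d : nat) (S : set 'rV[R]_N) : Prop :=
  (d <= N)%N /\
  forall x, S x -> exists (U W : set 'rV[R]_N) (f : 'rV[R]_N -> 'rV[R]_N),
    [/\ U x, diffeomorphism U W f & f @` (U `&` S) = W `&` coord_slice d].

End Smooth.

Section ExponentialFamily.
Variables (R : realType) (X : finType) (N : nat) (t : X -> 'rV[R]_N).

Definition dot (u v : 'rV[R]_N) : R := \sum_i u 0 i * v 0 i.

(* The law with natural parameter [theta] and sufficient statistic [t].  As [X]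
   is finite the normalizing sum always converges, so the natural parameter
   space of the full family is the whole (open) space 'rV_N. *)
Definition exp_family (theta : 'rV[R]_N) : 'rV[R]_#|{: X}| :=
  \row_i (expR (dot theta (t (enum_val i))) / \sum_x expR (dot theta (t x))).

Definition minimal_statistic : Prop :=
  forall (a : 'rV[R]_N) (c : R), (forall x, dot a (t x) = c) -> a = 0.

Definition curved_exponential_family (d : nat) (M : set 'rV[R]_#|{: X}|) : Prop :=
  [/\ minimal_statistic, M `<=` range exp_family &
      embedded_submanifold d (exp_family @^-1` M)].

End ExponentialFamily.

Section Saturated.
Variables (R : realType) (V : finType).

Definition zero_state : states V := [ffun=> false].

Definition nonzero_state : Type := {x : states V | x != zero_state}.
HB.instance Definition _ := Finite.on nonzero_state.

(* The statistics are the indicators of the nonzero states, so the natural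
   parameters of [p] are the [ln (p x / p 0)]. *)
Definition saturated_statistic (x : states V) : 'rV[R]_#|{: nonzero_state}| :=
  \row_i (val (enum_val i) == x)%:R.

Lemma dot_saturated (theta : 'rV[R]_#|{: nonzero_state}|) (y : nonzero_state) :
  dot theta (saturated_statistic (val y)) = theta 0 (enum_rank y).
Proof.
rewrite /dot (bigD1 (enum_rank y)) //= mxE enum_rankK eqxx mulr1.
rewrite big1 ?addr0// => i ne; rewrite mxE (inj_eq val_inj).
by rewrite -(inj_eq enum_rank_inj) enum_valK (negbTE ne) mulr0.
Qed.

Lemma dot_saturated0 (theta : 'rV[R]_#|{: nonzero_state}|) :
  dot theta (saturated_statistic zero_state) = 0.
Proof.
rewrite /dot big1// => i _; rewrite mxE.
by rewrite (negbTE (valP (enum_val i))) mulr0.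
Qed.

Lemma saturated_minimal : minimal_statistic saturated_statistic.
Proof.
move=> a c h; have c0 : c = 0 by rewrite -(h zero_state) dot_saturated0.
apply/rowP => i; rewrite mxE -c0 -(h (val (enum_val i))) dot_saturated.
by rewrite enum_valK.
Qed.

Lemma saturated_familyE :
  range (exp_family saturated_statistic) = [set p | pos_distribution p].
Proof.
apply/seteqP; split => [_ [theta _ <-]|p [p0 p1]] /=.
  set Z := \sum_x expR (dot theta (saturated_statistic x)).
  have Z0 : 0 < Z.
    rewrite /Z (bigD1 zero_state) //= ltr_pwDl ?expR_gt0//.
    by apply: sumr_ge0 => x _; exact: expR_ge0.
  have massE x : mass (exp_family saturated_statistic theta) x =
      expR (dot theta (saturated_statistic x)) / Z.
    by rewrite /mass mxE enum_rankK.
  split=> [x|]; first by rewrite massE divr_gt0 ?expR_gt0.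
  under eq_bigr do rewrite massE.
  by rewrite -mulr_suml mulfV ?gt_eqF.
pose theta : 'rV[R]_#|{: nonzero_state}| :=
  \row_i ln (mass p (val (enum_val i)) / mass p zero_state).
have expE x : expR (dot theta (saturated_statistic x)) =
    mass p x / mass p zero_state.
  have [->|xN0] := eqVneq x zero_state.
    by rewrite dot_saturated0 expR0 mulfV ?gt_eqF.
  rewrite -[x]/(val (exist _ x xN0 : nonzero_state)) dot_saturated mxE.
  by rewrite enum_rankK lnK// posrE divr_gt0.
exists theta => //; apply/rowP => i; rewrite mxE expE.
under eq_bigr do rewrite expE.
by rewrite -mulr_suml p1 mul1r invrK divfK ?gt_eqF// /mass enum_valK.
Qed.

End Saturated.

Arguments saturated_statistic : clear implicits.

(* Main.v *)
Require Import Defs.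
From mathcomp Require Import all_boot all_order all_algebra.
From mathcomp Require Import all_classical all_reals all_analysis.
From mathcomp Require Import ring.

(** The theorem rests on one change of coordinates for all positive laws, in
    which the model is a coordinate slice.

    Coordinates. Let [A] be an ancestral set with barren vertices [H]. The
    probabilities that [X_H = 0] and that the other vertices of [A] are in a given
    state, for all nonempty [A], are linear coordinates on the laws: by
    inclusion and exclusion they determine all ancestral marginals
    ([moment_marginal]), and they are as many as the nonzero states. Dividing by
    the marginal on [A \ H] turns each into a conditional probability
    ([barren_ratio]).

    Equations. Under the global Markov property this conditional probability
    depends only on the tail if [H] is a head, and splits over districts if it is
    not. So each coordinate is either one of the parameters
    [P(X_H = 0 | X_T = x_T)], or is given by a formula in coordinates of smaller
    ancestral sets or smaller supports ([markov_equations]). Conversely these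
    equations imply the global Markov property. By induction on [A] they show that
    every ancestral marginal is a product of functions of the sets
    [D] union [pa D], for [D] a district of [A] ([marginal_district_product]).
    If [C] m-separates two sets, then the ancestral set that the three sets
    generate is cut by [C] into two parts such that no [D] union [pa D] meets both
    ([msep_scopes]): a chain of such sets avoiding [C] would give an open walk,
    and from an open walk one extracts an open path ([open_walk_path]). The
    factorization then yields the conditional independence.

    Smoothness. Replace each determined coordinate by the difference between its
    value and the value that its formula predicts. This is a triangular map, affine
    in each coordinate with coefficients that depend on the preceding coordinates,
    so it is a diffeomorphism onto an open set [W] with an explicit inverse
    ([diffeomorphism_triangular], [diffeomorphism_chart]). It sends the model to
    the points of [W] at which the determined coordinates vanish, and its other
    coordinates restrict to the parameter map on the model ([chart_model],
    [chart_qmap]). Hence the set of parameters is a slice of [W], which is open;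
    the inverse parameterization is the restriction of a smooth map; and the
    chart, composed with the map from natural parameters to laws, flattens the
    model in the natural parameter space. *)

Set Implicit Arguments.
Unset Strict Implicit.
Unset Printing Implicit Defensive.

Import Order.TTheory GRing.Theory Num.Theory.
Import numFieldNormedType.Exports.

Local Open Scope set_scope.
Local Open Scope ring_scope.

(** * Ancestral sets, districts and heads *)

Section GraphTheory.
Import fintype boot.finset.
Variables (V : finType) (G : admg V).
Implicit Types (A B C D H K : {set V}) (v w h : V).

Lemma dir_connectN v w : dir G v w -> ~~ connect (dir G) w v.
Proof.
move=> vw; apply/negP => /connectP[s ws Ev].
have: cycle (dir G) (w :: s) by rewrite /= rcons_path ws -Ev vw.
by move/dir_acyclic.
Qed.

Definition ancestral A := [forall v in A, forall w, dir G w v ==> (w \in A)].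

Lemma ancestralP A :
  reflect (forall v w, v \in A -> dir G w v -> w \in A) (ancestral A).
Proof.
apply: (iffP forall_inP) => [h v w vA wv|h v vA].
  by move: (forallP (h v vA) w); rewrite wv.
by apply/forallP => w; apply/implyP => /(h _ _ vA).
Qed.

Lemma ancestral_connect A v w :
  ancestral A -> w \in A -> connect (dir G) v w -> v \in A.
Proof.
move=> /ancestralP anA wA /connectP[s vs Ew].
elim: s v vs Ew => [|u s IH] v /=; first by move=> _ <-.
by case/andP=> vu us Ew; exact: (anA u v (IH _ us Ew) vu).
Qed.

Lemma mem_an B w :
  reflect (exists2 v, v \in B & connect (dir G) w v) (w \in an G B).
Proof. by rewrite inE; apply: (iffP exists_inP). Qed.

Lemma an_ancestral B : ancestral (an G B).
Proof.
apply/ancestralP => v w /mem_an[u uB vu] wv; apply/mem_an; exists u => //.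
exact: connect_trans (connect1 wv) vu.
Qed.

Lemma sub_an B : B \subset an G B.
Proof. by apply/subsetP => v vB; apply/mem_an; exists v. Qed.

Lemma an_min A B : ancestral A -> B \subset A -> an G B \subset A.
Proof.
move=> anA /subsetP BA; apply/subsetP => v /mem_an[w /BA wA].
exact: ancestral_connect.
Qed.

Lemma an_eq A B : ancestral A -> B \subset A -> A \subset an G B -> an G B = A.
Proof. by move=> anA BA AB; apply/eqP; rewrite eqEsubset an_min. Qed.

(** A directed path from [v] to a vertex of an ancestral set stays in that set,
    so its first step already leads to a child of [v] there. *)
Lemma barrenP A v : ancestral A ->
  reflect (v \in A /\ forall w, dir G v w -> w \notin A) (v \in barren G A).
Proof.
move=> anA; rewrite !inE; apply: (iffP andP) => -[vA h]; split=> //.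
  move=> w vw; apply/negP => wA; move/eqP/setP/(_ w): h.
  rewrite !inE wA andbT; case: eqVneq => [Ew|_].
    by move: (dir_connectN vw); rewrite Ew connect0.
  by move=> /negbT/negP[]; apply/exists_inP; exists v; rewrite ?inE ?connect1.
apply/eqP/setP => w; rewrite !inE; apply/andP/eqP => [[/exists_inP[u]]|->].
  rewrite inE => /eqP-> /connectP[[|u' s] //= /andP[vu' us] Ew wA].
  have /negP[] := h _ vu'; apply: (ancestral_connect anA wA).
  by apply/connectP; exists s.
by split=> //; apply/exists_inP; exists v; rewrite ?inE.
Qed.

Lemma barren_sub A : barren G A \subset A.
Proof. by apply/subsetP => v; rewrite inE => /andP[]. Qed.

(** Among the descendants of a vertex in [A], one with the fewest descendants
    has no child in [A]. *)
Lemma an_barren A : ancestral A -> an G (barren G A) = A.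
Proof.
move=> anA; apply: an_eq => //; first exact: barren_sub.
apply/subsetP => v; have [n] := ubnP #|[set w in A | connect (dir G) v w]|.
elim: n v => // n IH v; rewrite ltnS => le_n vA.
have [vB|] := boolP (v \in barren G A); first exact: (subsetP (sub_an _)).
move=> nvB; have /exists_inP[w vw wA] : [exists w in dir G v, w \in A].
  apply: contraR nvB => /exists_inPn nch; apply/(barrenP _ anA).
  by split=> // w; exact: nch.
have /IH/(_ wA)/mem_an[u uB wu] :
    (#|[set u in A | connect (dir G) w u]| < n)%N.
  apply: leq_trans le_n; apply: proper_card; apply/properP; split.
    apply/subsetP => u; rewrite !inE => /andP[-> /=].
    exact: connect_trans (connect1 vw).
  by exists v; rewrite !inE vA ?connect0 ?dir_connectN.
by apply/mem_an; exists u => //; apply: connect_trans wu; apply: connect1.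
Qed.

Lemma ancestralD A K : ancestral A -> K \subset barren G A -> ancestral (A :\: K).
Proof.
move=> anA /subsetP KB; apply/ancestralP => v w.
rewrite !inE => /andP[_ vA] wv; rewrite (ancestralP _ anA v) // andbT.
by apply/negP => /KB/(barrenP _ anA)[_ /(_ _ wv)]; rewrite vA.
Qed.

Lemma barren_neq0 A : ancestral A -> A != set0 -> barren G A != set0.
Proof.
move=> anA; apply: contra => /eqP B0; rewrite -(an_barren anA) B0 -subset0.
by apply/subsetP => v /mem_an[w]; rewrite inE.
Qed.

Lemma barren_an H : barren G H = H -> barren G (an G H) = H.
Proof.
move=> bH; apply/setP => h; apply/barrenP/idP => [|[/mem_an[w wH]]|hH].
- exact: an_ancestral.
- move=> /connectP[[|u s] //= ]; first by move=> _ <-.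
  case/andP=> hu us Ew /(_ _ hu)/negP[].
  by apply/mem_an; exists w => //; apply/connectP; exists s.
split=> [|w hw]; first exact: (subsetP (sub_an _)).
apply/negP => /mem_an[k kH wk].
have hk : connect (dir G) h k by apply: connect_trans wk; apply: connect1.
have : k \in de G [set h] :&: H.
  by rewrite !inE kH andbT; apply/exists_inP; exists h; rewrite ?inE.
move: hH; rewrite -{1}bH inE => /andP[_ /eqP->]; rewrite inE => /eqP Ek.
by have := dir_connectN hw; rewrite -Ek wk.
Qed.

(** The variables on which one factor of the marginal law on [A] depends. *)
Definition scope A v : {set V} := dis G A [set v] :|: pa G (dis G A [set v]).

Lemma mem_dis1 A v w : (w \in dis G A [set v]) =
  [&& v \in A, w \in A & connect (induced_bidir G A) v w].
Proof.
rewrite inE; have [wA|] := boolP (w \in A); last by rewrite andbF.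
rewrite andTb; apply/exists_inP/andP => [[u]|[vA vw]].
  by rewrite !inE => /andP[uA /eqP<-].
by exists v => //; rewrite !inE vA eqxx.
Qed.

Lemma dis_refl A v : v \in A -> v \in dis G A [set v].
Proof. by move=> vA; rewrite mem_dis1 vA connect0. Qed.

Lemma induced_bidir_sym A : symmetric (induced_bidir G A).
Proof. by move=> v w; rewrite /induced_bidir /= bidir_sym andbCA. Qed.

Lemma connect_bidir_sym A : connect_sym (induced_bidir G A).
Proof. by apply: sym_connect_sym; exact: induced_bidir_sym. Qed.

Lemma dis_eq A v w : w \in dis G A [set v] -> dis G A [set w] = dis G A [set v].
Proof.
rewrite mem_dis1 => /and3P[vA wA vw]; apply/setP => u; rewrite !mem_dis1 vA wA.
by rewrite !andTb (same_connect (@connect_bidir_sym A) vw).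
Qed.

Lemma dis_subset A B v : A \subset B ->
  dis G A [set v] \subset dis G B [set v].
Proof.
move=> /subsetP AB; apply/subsetP => w; rewrite !mem_dis1 => /and3P[/AB-> /AB->].
rewrite !andTb; apply: connect_sub => x y /and3P[/AB xB /AB yB xy].
by apply: connect1; rewrite /induced_bidir /= xB yB.
Qed.

Lemma dis_sub A v : dis G A [set v] \subset A.
Proof. by apply/subsetP => w; rewrite mem_dis1 => /and3P[]. Qed.

Lemma mem_pa B w : reflect (exists2 v, v \in B & dir G w v) (w \in pa G B).
Proof. by rewrite inE; apply: (iffP exists_inP). Qed.

Lemma paS A B : A \subset B -> pa G A \subset pa G B.
Proof.
by move=> /subsetP AB; apply/subsetP => w /mem_pa[v /AB vB wv]; apply/mem_pa; exists v.
Qed.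

Lemma scope_subset A B v : A \subset B -> scope A v \subset scope B v.
Proof. by move=> AB; rewrite setUSS ?paS ?dis_subset. Qed.

Lemma scope_eq A v w : w \in dis G A [set v] -> scope A w = scope A v.
Proof. by move=> wv; rewrite /scope (dis_eq wv). Qed.

Lemma scope_sub A v : ancestral A -> scope A v \subset A.
Proof.
move=> anA; rewrite subUset dis_sub; apply/subsetP => w /mem_pa[u uD].
exact: (ancestralP _ anA u w (subsetP (dis_sub _ _) _ uD)).
Qed.

(** A childless vertex of [A] is nobody's parent, hence lies only in the scope
    of its own district. *)
Lemma scope_barren A h v : ancestral A -> h \in barren G A ->
  (h \in scope A v) = (h \in dis G A [set v]).
Proof.
move=> anA /(barrenP _ anA)[hA hB]; rewrite inE orbC; apply/orb_idl.
by move=> /mem_pa[w /(subsetP (dis_sub _ _)) wA /hB]; rewrite wA.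
Qed.

(** Removing vertices only splits districts, and a childless vertex belongs to
    the scope of its own district alone. *)
Lemma scope_dichotomy A B v w : ancestral A -> B \subset A ->
  scope B w \subset scope A v \/
  [disjoint scope B w & barren G A :&: dis G A [set v]].
Proof.
move=> anA BA; have [wv|wNv] := boolP (w \in dis G A [set v]).
  by left; rewrite -(scope_eq wv) scope_subset.
right; apply/pred0P => h /=; apply/negP => /andP[].
move=> /(subsetP (scope_subset _ BA)) hs; rewrite inE => /andP[hb hv].
rewrite scope_barren // in hs; case/negP: wNv.
rewrite -(dis_eq hv) (dis_eq hs) dis_refl //.
by move: hs; rewrite mem_dis1 => /and3P[].
Qed.

Lemma head_barren H : H \in heads G -> barren G H = H.
Proof. by rewrite inE => /and3P[_ /eqP]. Qed.

Lemma barren_an_head H : H \in heads G -> barren G (an G H) = H.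
Proof. by move/head_barren/barren_an. Qed.

Lemma head_neq0 H : H \in heads G -> H != set0.
Proof. by rewrite inE => /and3P[]. Qed.

Lemma head_dis H h : H \in heads G -> h \in H ->
  H \subset dis G (an G H) [set h] /\ dis G (an G H) H = dis G (an G H) [set h].
Proof.
rewrite inE => /and3P[_ _ /exists_inP[v vA Hv]] hH.
have hv := subsetP Hv _ hH; rewrite (dis_eq hv); split=> //.
apply/setP => w; rewrite mem_dis1 vA inE.
have [wA|] //= := boolP (w \in an G H); apply/exists_inP/idP => [[k]|vw].
  rewrite inE => /andP[kA /(subsetP Hv)]; rewrite mem_dis1 => /and3P[_ _ vk].
  exact: connect_trans vk.
move: hv; rewrite mem_dis1 => /and3P[_ hA vh]; exists h.
  by rewrite inE hA.
by apply: connect_trans vw; rewrite connect_bidir_sym.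
Qed.

(** No vertex of a head is a parent of its district, since the district consists
    of ancestors of the head and the head is barren. *)
Lemma head_tailE H h : H \in heads G -> h \in H ->
  H :|: tail G H = scope (an G H) h /\ tail G H = scope (an G H) h :\: H.
Proof.
move=> Hh hH; have [Hd Ed] := head_dis Hh hH.
have Npa k : k \in H -> k \notin pa G (dis G (an G H) [set h]).
  move=> kH; apply/negP => /mem_pa[w /(subsetP (dis_sub _ _)) wA kw].
  move: kH; rewrite -{1}(barren_an_head Hh) => /(barrenP _ (an_ancestral H)).
  by case=> _ /(_ _ kw); rewrite wA.
rewrite /tail Ed /scope; split; apply/setP => k; rewrite !inE.
  have [kH|] //= := boolP (k \in H).
  by move: (subsetP Hd _ kH); rewrite !inE => ->.
have [kH|] //= := boolP (k \in H).
by move: (Npa _ kH); rewrite inE => /negbTE.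
Qed.

Lemma an_supp_head H B : B \subset H :|: tail G H -> H \subset B ->
  H \in heads G -> an G B = an G H.
Proof.
move=> BHT HB Hh; have [h hH] := set0Pn _ (head_neq0 Hh).
have [E _] := head_tailE Hh hH.
apply: an_eq; first exact: an_ancestral.
  by apply: subset_trans BHT _; rewrite E scope_sub // an_ancestral.
by apply: an_min; [exact: an_ancestral | apply: subset_trans HB (sub_an _)].
Qed.

(** A barren set that is not a head thus has vertices both inside and outside
    the district of any of its vertices. *)
Lemma is_head_barrenE A h : ancestral A -> h \in barren G A ->
  (barren G A \in heads G) = (barren G A \subset dis G A [set h]).
Proof.
move=> anA hB; have EA := an_barren anA; apply/idP/idP => [Hh|Hd].
  by have [] := head_dis Hh hB; rewrite EA.
rewrite inE; apply/and3P; split; first by apply/set0Pn; exists h.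
  apply/eqP/setP => k; rewrite inE; have [kB|] //= := boolP (k \in barren G A).
  apply/eqP/setP => w; rewrite !inE; apply/andP/eqP => [[/exists_inP[u]]|->].
    rewrite inE => /eqP-> /connectP[[|u' s] //= /andP[ku us] Ew /andP[wA _]].
    have [_ /(_ _ ku)/negP[]] := barrenP _ anA kB.
    by apply: (ancestral_connect anA wA); apply/connectP; exists s.
  split; first by apply/exists_inP; exists k; rewrite ?inE.
  by move: kB; rewrite !inE.
rewrite EA; apply/exists_inP; exists h => //.
exact: (subsetP (barren_sub A)).
Qed.

End GraphTheory.

(** * Open walks and m-separation *)

Section Walks.
Import fintype boot.finset.
Variables (V : finType) (G : admg V).
Implicit Types (A B C D : {set V}) (v w x y : V) (e f : step V) (s t : seq (step V)).

(** The condition that a walk be open at the vertex between two consecutive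
    edges, which makes openness a property of adjacent list entries. *)
Definition passes C : rel (step V) := [rel e f |
  if e.1.2 && f.1.1 then e.2 \in an G C else e.2 \notin C].

Lemma blockedE C s : blocked G C s = ~~ sorted (passes C) s.
Proof.
elim: s => [|[[a b] y] [|[[a' b'] z] s] IH] //=.
by rewrite negb_and [in LHS]/= -IH /passes /=; case: ifP => //; rewrite negbK.
Qed.

Lemma walk_cat x s t :
  walk G x (s ++ t) = walk G x s && walk G (last x [seq e.2 | e <- s]) t.
Proof.
by elim: s x => //= -[[a b] y] s IH x; rewrite IH andbA.
Qed.

Lemma non_uniq_map (T T' : eqType) (g : T -> T') (s : seq T) :
  ~~ uniq (map g s) ->
  exists (s1 : seq T) (e : T) (s2 : seq T) (e' : T) (s3 : seq T),
    s = s1 ++ e :: s2 ++ e' :: s3 /\ g e = g e'.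
Proof.
elim: s => //= e s IH; rewrite negb_and negbK.
have [/mapP[e' /splitPr[s2 s3] Ee] _|_ /IH] := boolP (g e \in map g s).
  by exists [::], e, s2, e', s3.
by case=> s1 [e1 [s2 [e' [s3 [-> E]]]]]; exists (e :: s1), e1, s2, e', s3.
Qed.

(** A walk that leaves [x] and reaches its end through tails turns around at a
    first collider, which is a descendant of [x] and, the walk being open, an
    ancestor of [C]. *)
Lemma an_of_tails C x f t :
  walk G x (f :: t) -> sorted (passes C) (f :: t) ->
  ~~ f.1.1 -> ~~ (last f t).1.2 -> x \in an G C.
Proof.
elim: t x f => [|[[a' b'] z] t IH] x [[[] []] y] //=.
case/and3P=> xy yz zt /andP[pass op] _ lst.
have yC : y \in an G C.
  case: a' yz pass op lst => yz pass op lst; first exact: pass.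
  by apply: (IH y ((false, b'), z)) lst => //; apply/andP.
by apply: (ancestral_connect (an_ancestral G C) yC); apply: connect1.
Qed.

(** An open walk becomes an open path by cutting out the loop between two
    visits of a vertex: if the vertex becomes a collider without having been
    one before, then the loop left and came back through tails. *)
Lemma open_walk_path C x y s :
  walk G x s -> last x [seq e.2 | e <- s] = y -> sorted (passes C) s ->
  exists2 t, gpath G x y t & ~~ blocked G C t.
Proof.
have [n] := ubnP (size s); elim: n s => // n IH s; rewrite ltnS => le_n.
move=> ws Es os; have [us|] := boolP (uniq (vertices x s)).
  by exists s; rewrite /gpath ?ws ?us ?Es ?eqxx // blockedE os.
rewrite /= negb_and negbK => /orP[/mapP[e es Ex]|].
  case/splitPr: es ws Es os le_n => s1 s2; rewrite walk_cat map_cat last_cat /=.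
  case/andP=> _; case: e Ex => [[a b] z] /= <- /andP[_ ws] Es.
  rewrite size_cat sorted_cat_cons => /andP[_ /path_sorted os] le_n.
  apply: (IH s2) => //.
  by apply: leq_trans le_n; rewrite addnS ltnS leq_addl.
case/non_uniq_map=> s1 [[[a b] v] [s2 [[[a' b'] v'] [s3 [Es' /= Ev]]]]].
rewrite {}Es' -{}Ev in ws Es os le_n.
apply: (IH (s1 ++ ((a, b), v) :: s3)).
- by apply: leq_trans le_n; rewrite !size_cat /= size_cat /= !addnS !ltnS
    leq_add2l leq_addl.
- by move: ws; rewrite !walk_cat /= !walk_cat /= => /and5P[-> -> _ _ ->].
- by move: Es; rewrite !map_cat !last_cat /= !map_cat !last_cat /=.
have Es1 : sorted (passes C) (rcons s1 ((a, b), v)).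
  by move: os; rewrite sorted_cat_cons => /andP[].
rewrite sorted_cat_cons Es1 /=; case: s3 => //= f s3 in ws os Es le_n *.
move: os; rewrite sorted_cat_cons cat_path /=.
case/and5P=> _ o2 o2' pf of3; rewrite of3 andbT.
have opg : sorted (passes C) (rcons s2 ((a', b'), v)).
  by case: s2 o2 o2' {ws Es le_n} => //= g s2 /andP[_ o2] o2'; rewrite rcons_path o2.
have wg : walk G v (rcons s2 ((a', b'), v)).
  move: ws; rewrite walk_cat /= walk_cat -cats1 walk_cat /=.
  by case/and5P=> _ _ -> -> _.
have pg : path (passes C) ((a, b), v) (rcons s2 ((a', b'), v)).
  by rewrite rcons_path o2.
have El : (last ((a, b), v) (rcons s2 ((a', b'), v))) = ((a', b'), v).
  by rewrite last_rcons.
case Eg: (rcons s2 ((a', b'), v)) opg wg pg El => [|g t] /=; first by case: (s2) Eg.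
move=> opg wg /andP[peg _] El; move: peg pf; rewrite /passes /=.
case: b {Es1 ws Es o2 o2' le_n} => //=; case Ef: f.1.1 => //=; last by rewrite andbF.
case Ega: g.1.1 => //= _; case: b' {Eg} El => //= El _.
by apply: (@an_of_tails C v g t) => //; rewrite ?Ega ?El.
Qed.

Section Chain.
Variables (A0 B0 C : {set V}).
Hypothesis A0C : [disjoint A0 & C].
Let A := an G (A0 :|: B0 :|: C).

(** [c] tells whether the open walk from [A0] reaches [v] through an
    arrowhead. *)
Definition reached v (c : bool) := exists x s,
  [/\ x \in A0, walk G x s, last x [seq e.2 | e <- s] = v,
      sorted (passes C) s & (last ((false, false), x) s).1.2 = c].

Definition connected := exists2 b, b \in B0 & exists c, reached b c.

Lemma reached_ext v c a b w : reached v c -> edge G v a b w ->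
  (if c && a then v \in an G C else v \notin C) -> reached w b.
Proof.
move=> [x [s [xA ws Ev os Ec]]] vw pass.
exists x, (rcons s ((a, b), w)); split=> //.
- by rewrite -cats1 walk_cat ws /= Ev vw.
- by rewrite map_rcons last_rcons.
- case/lastP: s ws Ev os Ec => // s [[a' b'] u] _.
  rewrite map_rcons !last_rcons /= => -> os Eb.
  have -> : rcons (rcons s ((a', b'), v)) ((a, b), w) =
      s ++ ((a', b'), v) :: [:: ((a, b), w)] by rewrite -!cats1 -catA.
  by rewrite sorted_cat_cons os /= /passes /= Eb pass.
by rewrite last_rcons.
Qed.

Lemma notin_of_an v : v \notin an G C -> v \notin C.
Proof. by apply: contra; apply: (subsetP (sub_an _ _)). Qed.

Lemma notin_an_dir v w : dir G v w -> v \notin an G C -> w \notin an G C.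
Proof. by move=> vw; apply: contra => /(ancestralP _ _ (an_ancestral G C)); apply. Qed.

Lemma reached_up v : v \in an G A0 -> v \notin an G C -> reached v false.
Proof.
move=> /mem_an[x xA /connectP[s]]; elim: s v => [|u s IH] v /=.
  by move=> _ <- _; exists x, [::].
case/andP=> vu us Ex vC; have uC := notin_an_dir vu vC.
by apply: (reached_ext (IH u us Ex uC) (a := true)) => //=; exact: notin_of_an.
Qed.

Lemma connected_down v c : v \in an G B0 -> v \notin an G C -> reached v c ->
  connected.
Proof.
move=> /mem_an[x xB /connectP[s]]; elim: s v c => [|u s IH] v c /=.
  by move=> _ <- _ rv; exists x => //; exists c.
case/andP=> vu us Ex vC rv; apply: (IH u true us Ex (notin_an_dir vu vC)).
by apply: (reached_ext rv (a := false)) => //=; rewrite andbF notin_of_an.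
Qed.

(** At an ancestor of the end sets the walk can always go on along an
    arrowhead: a vertex that is closed as a collider has a directed path
    avoiding [C] to one of the end sets, and that path replaces the part of the
    walk on one side of the vertex. *)
Lemma reached_arrow v c b w : reached v c -> c || (v \notin C) -> v \in A ->
  edge G v true b w -> connected \/ reached w b.
Proof.
move=> rv cv vA vw; have [vC|vNC] := boolP (v \in an G C).
  by right; apply: (reached_ext rv vw); case: (c) cv => //=.
move: vA => /mem_an[u]; rewrite !inE -orbA => /or3P[] uX vu.
- right; apply: (reached_ext (v := v) (c := false)) vw _ => /=.
    by apply: reached_up => //; apply/mem_an; exists u.
  exact: notin_of_an.
- by left; apply: connected_down vNC rv; apply/mem_an; exists u.
- by case/mem_an: vNC; exists u.
Qed.

(** A scope is its district with edges from the parents added, so a walk can go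
    from one vertex of the scope to another meeting only colliders between. *)
Lemma reached_scope u v w c : v \in scope G A u -> w \in scope G A u ->
  v \notin C -> reached v c -> connected \/ exists c', reached w c'.
Proof.
set D := dis G A [set u] => vu wu vC rv.
have [Done|[v' [c' [vD rv' cv']]]] : connected \/
    exists v' c', [/\ v' \in D, reached v' c' & c' || (v' \notin C)].
  move: vu; rewrite inE => /orP[vD|/mem_pa[v' vD vv']].
    by right; exists v, c; rewrite vC orbT.
  right; exists v', true; split=> //.
  by apply: (reached_ext rv (a := false)) => //; rewrite andbF.
  by left.
have inD y : y \in D -> connected \/
    exists c, reached y c /\ c || (y \notin C).
  rewrite /D -(dis_eq vD) mem_dis1 => /and3P[_ _].
  case/connectP=> s; elim: s v' c' rv' cv' {vD} => [|z s IH] x cx rx xC /=.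
    by move=> _ ->; right; exists cx.
  case/andP=> /and3P[xA zA xz] zs Ey.
  have [|rz] := reached_arrow rx xC xA (xz : edge G x true true z); first by left.
  exact: IH rz _ zs Ey.
move: wu; rewrite inE => /orP[/inD[|[c1 [rw _]]]|/mem_pa[w' wD ww']]; try by left.
  by right; exists c1.
have [|[c1 [rw' cw']]] := inD _ wD; first by left.
have wA := subsetP (dis_sub _ _ _) _ wD.
have [|rw] := reached_arrow rw' cw' wA (ww' : edge G w' true false w); first by left.
by right; exists false.
Qed.

(** [S] consists of the vertices joined to [A0] by a chain of vertices outside
    [C] in which neighbours share a scope; a chain that reached [B0] would yield
    an open walk. *)
Lemma msep_scopes : msep G A0 B0 C -> exists S : {set V},
  [/\ A0 \subset S, [disjoint B0 & S], S \subset A :\: C &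
      forall u, [disjoint scope G A u & S] \/ scope G A u \subset S :|: C].
Proof.
move=> sep; pose L := [rel v w | [&& v \notin C, w \in A :\: C &
  [exists u, (v \in scope G A u) && (w \in scope G A u)]]].
have AA : A0 :|: B0 :|: C \subset A by exact: sub_an.
have A0A x : x \in A0 -> x \in A :\: C.
  move=> xA; rewrite inE (disjointFr A0C xA) /=; apply: (subsetP AA).
  by rewrite !inE xA.
have NC : ~ connected.
  move=> [b bB [c [x [s [xA ws Eb os _]]]]].
  have [t pt] := open_walk_path ws Eb os; by rewrite (sep _ _ xA bB).
exists [set v in A :\: C | [exists x in A0, connect L x v]]; split.
- apply/subsetP => x xA; rewrite inE A0A //=; by apply/exists_inP; exists x.
- apply/pred0P => b /=; apply/negP => /andP[bB]; rewrite inE => /andP[_].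
  case/exists_inP=> x xA /connectP[s xs Eb]; apply: (NC); exists b => //.
  have : exists c, reached x c by exists false, x, [::].
  elim: s x xs Eb {xA} => [|z s IH] x /=; first by move=> _ ->.
  case/andP=> /and3P[xC zA /existsP[u /andP[xu zu]]] zs Eb [c rx].
  have [/NC//|rz] := reached_scope xu zu xC rx.
  exact: IH zs Eb rz.
- by apply/subsetP => v; rewrite inE => /andP[].
move=> u; have [|/pred0Pn[v /= /andP[vu]]] := boolP [disjoint scope G A u & _].
  by left.
rewrite inE => /andP[vA /exists_inP[x xA xv]]; right; apply/subsetP => w wu.
rewrite in_setU orbC; have [wC|wNC] //= := boolP (w \in C).
have wA : w \in A :\: C.
  by rewrite inE wNC (subsetP (scope_sub u (an_ancestral _ _))).
rewrite inE wA; apply/exists_inP; exists x => //; apply: connect_trans xv _.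
apply: connect1; rewrite /= wA; move: vA; rewrite inE => /andP[-> _] /=.
by apply/existsP; exists u; rewrite vu.
Qed.

End Chain.

Section LocalSeparation.
Variables (A C : {set V}).
Hypotheses (anA : ancestral G A) (CA : C \subset A).

(** The directed stretch that leaves [y] stops at the end of the walk or at an
    open collider, and both lie in [A]. *)
Lemma open_walk_child y y' b t :
  walk G y (((false, b), y') :: t) -> sorted (passes C) (((false, b), y') :: t) ->
  last y' [seq e.2 | e <- t] \in A -> y' \in A.
Proof.
elim: t y y' b => [|[[a' b'] z] t IH] y y' b //=.
case: b => //; case/and3P=> yy' yz zt /andP[pass op] lst.
case: a' yz pass op => yz pass op.
  exact: (subsetP (an_min anA CA)).
have zA : z \in A.
  by apply: (IH y' z b') lst => //; apply/andP.
by case: b' yz {op pass} => // yz; exact: (ancestralP _ _ anA _ _ zA yz).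
Qed.
End LocalSeparation.

(** A childless vertex of [A] can only be left backwards, and a walk that stays
    open then remains in the district until it meets a parent in the
    conditioning set. *)
Lemma msep_scope A v : ancestral G A ->
  let H := barren G A :&: dis G A [set v] in
  msep G H (A :\: scope G A v) (scope G A v :\: H).
Proof.
move=> anA H x z; set W := scope G A v; set C := W :\: H.
have WA : W \subset A by exact: scope_sub.
have CA : C \subset A by apply: subset_trans WA; exact: subsetDl.
have DW : dis G A [set v] \subset W by exact: subsetUl.
rewrite /H inE => /andP[xB xD]; rewrite inE => /andP[zW zA] s /and3P[ws _ /eqP Ez].
rewrite blockedE; apply/negP => os.
have nchild y y' : y \in barren G A -> dir G y y' -> y' \notin A.
  by move=> /(barrenP _ anA)[_]; apply.
have lem t : forall y b u, y \in dis G A [set v] -> walk G y (((true, b), u) :: t) ->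
    last u [seq e.2 | e <- t] = z -> ~~ sorted (passes C) (((true, b), u) :: t).
  elim: t => [|[[a' b'] y'] t IH] y b u yD.
    move=> /=; rewrite andbT => yu Eu; case/negP: zW; rewrite -Eu.
    have yA := subsetP (dis_sub _ _ _) _ yD.
    case: b yu => yu.
      rewrite (subsetP DW) // -(dis_eq yD) mem_dis1 yA /=.
      have uA : u \in A by rewrite Eu.
      by rewrite uA; apply: connect1; rewrite /induced_bidir /= yA uA.
    by rewrite inE; apply/orP; right; apply/mem_pa; exists y.
  rewrite [walk _ _ _]/= => /andP[yu wt] Ez'.
  apply/negP => /= /andP[pass op]; move: pass; rewrite /passes /=.
  have yA := subsetP (dis_sub _ _ _) _ yD.
  case: b yu => /= yu; last first.
    have uW : u \in W by rewrite inE; apply/orP; right; apply/mem_pa; exists y.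
    rewrite inE uW andbT negbK inE => /andP[/nchild/(_ yu)].
    by rewrite yA.
  have uD : u \in A -> u \in dis G A [set v].
    move=> uA; rewrite -(dis_eq yD) mem_dis1 yA uA.
    by apply: connect1; rewrite /induced_bidir /= yA uA.
  case: a' wt op Ez' => wt op Ez'.
    move=> uC; have uA : u \in A := subsetP (an_min anA CA) _ uC.
    by have /negP := IH u b' y' (uD uA) wt Ez'; apply.
  have y'A : y' \in A.
    by apply: (open_walk_child anA CA wt op); move: zA; rewrite -Ez'.
  have uA : u \in A.
    by case: (b') wt => //= /andP[/(ancestralP _ _ anA _ _ y'A)].
  rewrite inE (subsetP DW) ?uD // andbT negbK inE => /andP[/nchild uN _].
  by case: (b') wt => //= /andP[/uN]; rewrite y'A.
case: s ws Ez os => [|[[[] b] u] t] ws /= Ez os.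
- by case/negP: zW; rewrite -Ez (subsetP DW).
- by have /negP := lem t x b u xD ws Ez; apply.
have uA : u \in A by apply: (open_walk_child anA CA ws os); rewrite Ez.
by case: b ws {os} => //= /andP[/(nchild _ _ xB)]; rewrite uA.
Qed.

End Walks.

(** * Marginals of functions on binary states *)

Section Marginals.
Import fintype boot.finset.
Variables (R : realFieldType) (V : finType).
Implicit Types (f g : states V -> R) (A B H K X Y : {set V}) (v h : V)
  (x y z : states V).

Definition agree B x y := [forall v in B, x v == y v].

Lemma agreeP B x y : reflect {in B, x =1 y} (agree B x y).
Proof.
by apply: (iffP forall_inP) => xy v vB; [exact/eqP/xy | rewrite xy].
Qed.

Definition overlay K y x : states V := [ffun v => if v \in K then y v else x v].

Definition depends f X := forall x y, {in X, x =1 y} -> f x = f y.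

Definition sumout K f x := \sum_(y | agree (~: K) x y) f y.

Definition marginal f B := sumout (~: B) f.

Lemma dependsW f X Y : X \subset Y -> depends f X -> depends f Y.
Proof. by move=> /subsetP XY fX x y xy; apply: fX => v /XY; exact: xy. Qed.

Lemma eq_sumout K f g : f =1 g -> sumout K f =1 sumout K g.
Proof. by move=> fg x; apply: eq_bigr => y _; rewrite fg. Qed.

(** The intermediate state of the iterated sum is recovered from the final one,
    because [K1] and [K2] are disjoint. *)
Lemma sumout_sumout K1 K2 f x : [disjoint K1 & K2] ->
  sumout K1 (sumout K2 f) x = sumout (K1 :|: K2) f x.
Proof.
move=> dK; rewrite /sumout.
rewrite (exchange_big_dep (fun z => agree (~: (K1 :|: K2)) x z)) /=; last first.
  move=> y z /agreeP xy /agreeP yz; apply/agreeP => v.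
  by rewrite !inE negb_or => /andP[v1 v2]; rewrite xy ?yz ?inE.
apply: eq_bigr => z /agreeP xz.
rewrite (big_pred1 (overlay K1 z x)) // => y /=; apply/andP/eqP.
  case=> /agreeP xy /agreeP yz; apply/ffunP => v; rewrite ffunE.
  have [v1|v1] := ifPn; last by rewrite -xy // inE.
  by rewrite yz // inE (disjointFr dK v1).
move=> ->; split; apply/agreeP => v; rewrite !inE ffunE; first by move/negbTE->.
by have [//|v1 v2] := ifPn; rewrite xz // !inE negb_or v1.
Qed.

Lemma sumout_depends K f X : depends f X -> depends (sumout K f) (X :\: K).
Proof.
move=> fX x x' xx'; rewrite /sumout.
rewrite (reindex_onto (fun y => overlay K y x) (fun y => overlay K y x')) /=.
  apply: eq_big => [y|y /andP[_ /eqP <-]].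
    apply/andP/agreeP => [[_ /eqP <-] v|xy].
      by rewrite inE !ffunE => /negbTE ->.
    split; first by apply/agreeP => v; rewrite inE !ffunE => /negbTE->.
    apply/eqP/ffunP => v; rewrite !ffunE; case: (boolP (v \in K)) => // vK.
    by rewrite xy ?inE.
  apply: fX => v vX; rewrite !ffunE; case: (boolP (v \in K)) => // vK.
  by rewrite xx' // inE vK.
move=> y /agreeP xy; apply/ffunP => v; rewrite !ffunE; case: (boolP (v \in K)) => // vK.
by rewrite xy ?inE.
Qed.

Lemma sumoutM K f g x : depends g (~: K) ->
  sumout K (fun y => f y * g y) x = sumout K f x * g x.
Proof.
move=> gK; rewrite [RHS]mulr_suml; apply: eq_bigr => y /agreeP xy.
by rewrite -(gK _ _ xy).
Qed.

Definition set_state h (b : bool) x : states V :=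
  [ffun v => if v == h then b else x v].

Lemma sumout1 h f x :
  sumout [set h] f x = f (set_state h false x) + f (set_state h true x).
Proof.
have agreeE b : agree (~: [set h]) x (set_state h b x).
  by apply/agreeP => v; rewrite !inE ffunE => /negbTE->.
rewrite /sumout (bigD1 (set_state h false x)) //=; congr (_ + _).
rewrite (big_pred1 (set_state h true x)) // => y /=; apply/andP/eqP.
  case=> /agreeP xy yN; apply/ffunP => v; rewrite ffunE; case: eqVneq => [->|vh].
    apply: contraNT yN => yh; apply/eqP/ffunP => w; rewrite ffunE.
    case: eqVneq => [->|wh]; first exact/negbTE.
    by rewrite -xy // !inE.
  by rewrite -xy // !inE.
move=> ->; split=> //; apply/eqP => /ffunP/(_ h); rewrite !ffunE eqxx.
by [].
Qed.

Lemma marginal_depends f B : depends (marginal f B) B.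
Proof.
have fT : depends f setT
  by move=> x y xy; congr f; apply/ffunP => v; apply: xy; rewrite inE.
apply: (@dependsW (sumout (~: B) f) ([set: V] :\: ~: B)).
  by rewrite setDE setCK setTI.
exact: sumout_depends.
Qed.

Lemma marginalD f B K x : K \subset B ->
  marginal f (B :\: K) x = sumout K (marginal f B) x.
Proof.
move=> KB; rewrite /marginal sumout_sumout; last first.
  by rewrite disjoints_subset setCK.
by congr (sumout _ f x); apply/setP => v; rewrite !inE negb_and negbK.
Qed.

Lemma marginal_gt0 f B x : (forall y, 0 < f y) -> 0 < marginal f B x.
Proof.
move=> f0; rewrite /marginal /sumout (bigD1 x) /=; last exact/agreeP.
by rewrite ltr_pwDl // sumr_ge0 // => y _; exact: ltW.
Qed.

Lemma marginal_neq0 f B x : (forall y, 0 < f y) -> marginal f B x != 0.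
Proof. by move=> f0; rewrite gt_eqF ?marginal_gt0. Qed.

Lemma marginalT f x : marginal f setT x = f x.
Proof.
rewrite /marginal /sumout setCT setC0 (big_pred1 x) // => y /=.
apply/agreeP/eqP => [xy|-> //]; apply/ffunP => v.
by rewrite -xy ?inE.
Qed.

Lemma marginal_split f B h x : h \in B ->
  marginal f (B :\ h) x =
  marginal f B (set_state h false x) + marginal f B (set_state h true x).
Proof. by move=> hB; rewrite marginalD ?sub1set // sumout1. Qed.

(** This is the independence of the variables in [K1] and [K2] given the others
    in [B]: summing out one of the two sets acts on a single factor. *)
Lemma marginal_independent f B K1 K2 F1 F2 x :
  K1 \subset B -> K2 \subset B -> [disjoint K1 & K2] ->
  (forall y, marginal f B y = F1 y * F2 y) ->
  depends F1 (~: K2) -> depends F2 (~: K1) ->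
  marginal f B x * marginal f (B :\: (K1 :|: K2)) x =
  marginal f (B :\: K1) x * marginal f (B :\: K2) x.
Proof.
move=> K1B K2B dK fE d1 d2.
have E1 y : marginal f (B :\: K1) y = sumout K1 F1 y * F2 y.
  by rewrite marginalD // (eq_sumout _ fE) sumoutM.
have E2 y : marginal f (B :\: K2) y = F1 y * sumout K2 F2 y.
  rewrite marginalD // (eq_sumout _ fE) mulrC -(sumoutM _ _ d1).
  by apply: eq_sumout => z; rewrite mulrC.
rewrite -setDDl marginalD; last first.
  by rewrite subsetD K2B disjoint_sym.
rewrite (eq_sumout _ E1) E1 E2.
have d1' : depends (sumout K1 F1) (~: K2).
  exact: dependsW (subsetDl _ _) (sumout_depends (K := K1) d1).
under eq_sumout do rewrite mulrC.
by rewrite sumoutM // fE; ring.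
Qed.

(** Switching a vertex of [H] from 1 to 0 only changes the sign of [f]. *)
Lemma alternating0 H f :
  (forall h x, h \in H -> f (set_state h false x) + f (set_state h true x) = 0) ->
  (forall x, (forall h, h \in H -> x h = false) -> f x = 0) ->
  forall x, f x = 0.
Proof.
move=> fH f0 x; have [n] := ubnP #|[set h in H | x h]|.
elim: n x => // n IH x; rewrite ltnS => le_n.
have [/existsP[h /andP[hH xh]]|/existsPn x0] := boolP [exists h, (h \in H) && x h].
  have /(_ x) := fH h _ hH; rewrite IH ?add0r.
    by move <-; congr f; apply/ffunP => v; rewrite ffunE; case: eqVneq => // ->.
  apply: leq_trans le_n; apply: proper_card; apply/properP; split.
    by apply/subsetP => v; rewrite !inE ffunE; case: eqVneq => // _; rewrite andbF.
  by exists h; rewrite !inE ?hH ?xh // ffunE eqxx andbF.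
apply: f0 => h hH; apply/negbTE; move: (x0 h).
by rewrite hH.
Qed.

End Marginals.

(** * Factorization of ancestral marginals over districts *)

Section Factorization.
Import fintype boot.finset.
Variables (R : realFieldType) (V : finType) (G : admg V).
Implicit Types (f g : states V -> R) (A B H K : {set V}) (v h : V)
  (x y z : states V).

(** Closure under products and inverses spares an enumeration of the districts,
    and makes the class for a subset of [A] part of the class for [A]. *)
Inductive district_product A : (states V -> R) -> Prop :=
| product_const f : depends f set0 -> district_product A f
| product_scope v f : depends f (scope G A v) -> district_product A f
| productM f g : district_product A f -> district_product A g ->
    district_product A (fun x => f x * g x)
| productV f : district_product A f -> district_product A (fun x => (f x)^-1).

Lemma district_productS A B f : A \subset B ->
  district_product A f -> district_product B f.
Proof.
move=> AB; elim=> [{}f f0|v {}f fv|{}f g _ fB _ gB|{}f _ fB].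
- exact: product_const.
- apply: (product_scope (v := v)); apply: dependsW fv; exact: scope_subset.
- exact: productM.
exact: productV.
Qed.

(** Each factor goes to a side on which its scope is allowed. *)
Lemma district_product_split A f K1 K2 :
  (forall v, [disjoint scope G A v & K1] \/ [disjoint scope G A v & K2]) ->
  district_product A f ->
  exists F1 F2, [/\ depends F1 (~: K2), depends F2 (~: K1) &
    forall y, f y = F1 y * F2 y].
Proof.
have one X : depends (fun _ : states V => 1 : R) X by [].
move=> AK; elim=> [{}f f0|v {}f fv|{}f g _|{}f _].
- exists f, (fun=> 1); split=> // [|y]; last by rewrite mulr1.
  exact: dependsW (sub0set _) f0.
- have [d|d] := AK v.
    exists (fun=> 1), f; split=> // [|y]; last by rewrite mul1r.
    by apply: dependsW fv; rewrite -disjoints_subset.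
  exists f, (fun=> 1); split=> // [|y]; last by rewrite mulr1.
  by apply: dependsW fv; rewrite -disjoints_subset.
- move=> [F1 [F2 [d1 d2 E]]] _ [F1' [F2' [d1' d2' E']]].
  exists (fun x => F1 x * F1' x), (fun x => F2 x * F2' x); split=> [x y xy|x y xy|y].
  + by rewrite (d1 _ _ xy) (d1' _ _ xy).
  + by rewrite (d2 _ _ xy) (d2' _ _ xy).
  by rewrite E E' mulrACA.
move=> [F1 [F2 [d1 d2 E]]].
exists (fun x => (F1 x)^-1), (fun x => (F2 x)^-1); split=> [x y xy|x y xy|y].
- by rewrite (d1 _ _ xy).
- by rewrite (d2 _ _ xy).
by rewrite E invfM.
Qed.

Definition supp z : {set V} := [set v | z v].

Definition zeroed K x : states V := overlay K (zero_state V) x.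

Lemma zeroedE K x v : zeroed K x v = (v \notin K) && x v.
Proof. by rewrite !ffunE; case: ifP. Qed.

(** With [H] the barren vertices of [A], the conditional probability of the
    state of [H] given the state of the rest of [A]. *)
Definition barren_ratio f A x := marginal f A x / marginal f (A :\: barren G A) x.

Definition chosen_district A : {set V} :=
  if [pick h in barren G A] is Some h then dis G A [set h] else set0.

(** What the Markov property makes of [barren_ratio]. A head depends on the rest
    of [A] through its tail only, so the vertices outside may be put at 0; a
    barren set that is not a head splits into the part in one district and the
    rest, which are independent given the other vertices of [A]. *)
Definition predicted f A x :=
  let H := barren G A in let D := chosen_district A in
  if H \in heads G then barren_ratio f A (zeroed (~: (H :|: tail G H)) x)
  else marginal f (A :\: (H :&: D)) x * marginal f (A :\: (H :\: D)) x /
       marginal f (A :\: H) x ^+ 2.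

(** A state [z] stands for one parameter of the saturated model: the probability
    that the barren vertices of the ancestral set [anset z] are at 0 and that its
    other vertices are as in [z]. *)
Definition anset z := an G (supp z).

Definition tailstate z := zeroed (barren G (anset z)) z.

Definition markov_equations f :=
  forall z, z != zero_state V ->
    barren_ratio f (anset z) (tailstate z) = predicted f (anset z) (tailstate z).

Lemma anset_ancestral z : ancestral G (anset z).
Proof. exact: an_ancestral. Qed.

(** The inverse of [z |-> (anset z, tailstate z)]. *)
Definition cell A x : states V :=
  [ffun v => (v \in barren G A) || (v \in A) && x v].

Lemma anset_cell A x : ancestral G A -> anset (cell A x) = A.
Proof.
move=> anA; apply: an_eq => //.
  apply/subsetP => v; rewrite inE ffunE => /orP[|/andP[]//].
  exact: (subsetP (barren_sub G A)).
rewrite -{1}(an_barren anA); apply: an_min; first exact: an_ancestral.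
apply: subset_trans (sub_an _ _); apply/subsetP => v vB.
by rewrite inE ffunE vB.
Qed.

Lemma tailstate_cell A x : ancestral G A ->
  (forall h, h \in barren G A -> x h = false) ->
  {in A, tailstate (cell A x) =1 x}.
Proof.
move=> anA x0 v vA; rewrite /tailstate anset_cell // zeroedE ffunE vA.
by case: (boolP (v \in barren G A)) => // /x0->.
Qed.

Lemma cell_neq0 A x : ancestral G A -> A != set0 -> cell A x != zero_state V.
Proof.
move=> anA A0; apply: contra A0 => /eqP E; rewrite -(anset_cell x anA) E.
rewrite -subset0; apply: an_min; first by apply/ancestralP => v w; rewrite inE.
by apply/subsetP => v; rewrite !inE ffunE.
Qed.

Lemma barren_ratio_depends f A : depends (barren_ratio f A) A.
Proof.
move=> x y xy; congr (_ / _); first exact: marginal_depends.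
by apply: (dependsW (subsetDl _ _) (@marginal_depends R V f _)).
Qed.

Lemma zeroed_eq K x y v : x v = y v -> zeroed K x v = zeroed K y v.
Proof. by rewrite !zeroedE => ->. Qed.

Lemma predicted_depends f A : depends (predicted f A) A.
Proof.
have dD K : depends (marginal f (A :\: K)) A.
  by apply: (dependsW (subsetDl _ _) (@marginal_depends R V f _)).
move=> x y xy; rewrite /predicted; case: ifP => _.
  by apply: barren_ratio_depends => v vA; apply: zeroed_eq; exact: xy.
by rewrite !(dD _ _ _ xy).
Qed.

Lemma markov_equations_at f A x : markov_equations f -> ancestral G A -> A != set0 ->
  (forall h, h \in barren G A -> x h = false) ->
  barren_ratio f A x = predicted f A x.
Proof.
move=> fE anA A0 x0; have := fE _ (cell_neq0 x anA A0); rewrite anset_cell //.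
have Ex := tailstate_cell anA x0.
by rewrite (@barren_ratio_depends f A _ _ Ex) (@predicted_depends f A _ _ Ex).
Qed.

Section Positive.
Variable f : states V -> R.
Hypothesis f0 : forall x, 0 < f x.

(** The factors that are not functions of the scope do not involve the vertices
    summed out, so they cancel. *)
Lemma marginal_ratio_depends A B v : ancestral G A -> B \subset A ->
  let H := barren G A :&: dis G A [set v] in
  district_product B (marginal f B) ->
  depends (fun x => marginal f B x / marginal f (B :\: H) x) (scope G A v).
Proof.
move=> anA BA H dB; set W := scope G A v.
have [|F1 [F2 [d1 d2 E]]] := district_product_split (K1 := H) (K2 := ~: W) _ dB.
  move=> w; have [sw|] := scope_dichotomy v w anA BA; last by left.
  by right; rewrite disjoints_subset setCK.
rewrite setCK in d1; have -> : B :\: H = B :\: (H :&: B).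
  by apply/setP => u; rewrite !inE; case: (u \in B); rewrite ?andbT ?andbF.
have dF : depends (sumout (H :&: B) F1) W.
  exact: dependsW (subsetDl _ _) (sumout_depends (K := H :&: B) d1).
have mE x : marginal f (B :\: (H :&: B)) x = sumout (H :&: B) F1 x * F2 x.
  rewrite marginalD ?subsetIr // (eq_sumout _ E) sumoutM //.
  by apply: dependsW d2; rewrite setCS subsetIl.
have cancel x : marginal f B x / marginal f (B :\: (H :&: B)) x =
    F1 x / sumout (H :&: B) F1 x.
  have := marginal_neq0 B x f0; have := marginal_neq0 (B :\: (H :&: B)) x f0.
  rewrite E mE mulf_eq0 negb_or => /andP[s0 F0] _.
  by rewrite -mulf_div divff // mulr1.
by move=> x y xy; rewrite !cancel (d1 _ _ xy) (dF _ _ xy).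
Qed.

Lemma cross_independent A B v K1 K2 x : ancestral G A -> B \subset A ->
  K1 \subset barren G A :&: dis G A [set v] ->
  K2 \subset barren G A :\: dis G A [set v] ->
  K1 \subset B -> K2 \subset B ->
  district_product B (marginal f B) ->
  marginal f B x * marginal f (B :\: (K1 :|: K2)) x =
  marginal f (B :\: K1) x * marginal f (B :\: K2) x.
Proof.
move=> anA BA K1H /subsetP K2H K1B K2B dB.
have [|F1 [F2 [d1 d2 E]]] := district_product_split (K1 := K1) (K2 := K2) _ dB.
  move=> w; have [/subsetP sw|d] := scope_dichotomy v w anA BA; last first.
    by left; apply: disjointWr d.
  right; apply/pred0P => u /=; apply/negP => /andP[/sw uv /K2H].
  rewrite inE => /andP[/negP uD uB]; apply: uD.
  by rewrite -scope_barren.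
apply: marginal_independent E d1 d2 => //.
apply/pred0P => u /=; apply/negP => /andP[/(subsetP K1H)].
by rewrite inE => /andP[_ uD] /K2H; rewrite inE uD.
Qed.

Lemma set_state_out h b x A : h \notin A -> {in A, set_state h b x =1 x}.
Proof.
by move=> hA v vA; rewrite ffunE; case: eqVneq vA hA => // -> ->.
Qed.

(** The two values at a head vertex [h] add up to a quotient of marginals without
    [h], which by hypothesis depends on the scope only; so the equation at states
    vanishing on the head extends to all states. *)
Lemma head_ratio_depends A : ancestral G A -> barren G A \in heads G ->
  markov_equations f ->
  (forall h, h \in barren G A -> district_product (A :\ h) (marginal f (A :\ h))) ->
  exists2 v, v \in A & depends (barren_ratio f A) (scope G A v).
Proof.
move=> anA Hh fE IH; set H := barren G A.
have [v vH] := set0Pn _ (head_neq0 Hh).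
have [hd _] := head_dis Hh vH; rewrite an_barren // in hd.
have [EW _] := head_tailE Hh vH; rewrite an_barren // in EW.
have HE : barren G A :&: dis G A [set v] = H by apply/setIidPl.
exists v; first exact: (subsetP (barren_sub G A)).
set W := scope G A v in EW *.
have A0 : A != set0 by apply/set0Pn; exists v; exact: (subsetP (barren_sub G A)).
have key : forall x, barren_ratio f A x - barren_ratio f A (zeroed (~: W) x) = 0.
  apply: (@alternating0 _ _ H) => [h x hH|x x0]; last first.
    rewrite (markov_equations_at fE anA A0 x0) /predicted ifT //.
    by rewrite EW subrr.
  have hA : h \in A by apply: (subsetP (barren_sub G A)).
  have hW : h \in W by rewrite -EW inE hH.
  pose s y := marginal f (A :\ h) y / marginal f (A :\: H) y.
  have sE y : barren_ratio f A (set_state h false y) +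
      barren_ratio f A (set_state h true y) = s y.
    rewrite /barren_ratio /s marginal_split // mulrDl -!/(barren G A) -/H.
    by congr (_ / _ + _ / _); apply: marginal_depends; apply: set_state_out; rewrite inE hH.
  have sW : depends s W.
    have := marginal_ratio_depends (B := A :\ h) (v := v) anA (subsetDl _ _) (IH h hH).
    rewrite HE setDDl; have -> : [set h] :|: H = H by apply/setUidPr; rewrite sub1set.
    by [].
  have zE b : zeroed (~: W) (set_state h b x) = set_state h b (zeroed (~: W) x).
    apply/ffunP => u; rewrite zeroedE !ffunE inE negbK.
    by case: eqVneq => [->|_]; rewrite ?hW //=; case: (u \in W).
  rewrite !zE [LHS](_ : _ = s x - s (zeroed (~: W) x)); last by rewrite -!sE; ring.
  rewrite (sW x (zeroed (~: W) x)) ?subrr // => u uW.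
  by rewrite zeroedE inE uW.
move=> x y xy; have := key x; have := key y; move=> /subr0_eq-> /subr0_eq->.
congr (barren_ratio f A _); apply/ffunP => u; rewrite !zeroedE inE negbK.
by case: (boolP (u \in W)) => // /xy->.
Qed.

Lemma chosen_districtP A : ancestral G A -> A != set0 ->
  exists2 h, h \in barren G A & chosen_district A = dis G A [set h].
Proof.
move=> anA A0; have [h hB] := set0Pn _ (barren_neq0 anA A0).
rewrite /chosen_district; case: pickP => [k kB|/(_ h)]; first by exists k.
by rewrite hB.
Qed.

(** Summed over the states of one barren vertex [h], the identity becomes an
    independence in [A :\ h], which the factorization there provides; so it only
    has to hold at states vanishing on the barren vertices. *)
Lemma nonhead_independent A x : ancestral G A -> A != set0 -> barren G A \notin heads G ->
  markov_equations f ->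
  (forall h, h \in barren G A -> district_product (A :\ h) (marginal f (A :\ h))) ->
  let H := barren G A in let D := chosen_district A in
  marginal f A x * marginal f (A :\: H) x =
  marginal f (A :\: (H :&: D)) x * marginal f (A :\: (H :\: D)) x.
Proof.
move=> anA A0 Hh fE IH H D; have [v vH] := chosen_districtP anA A0.
rewrite -/D => ED; set H1 := H :&: D; set H2 := H :\: D.
have HU : H1 :|: H2 = H by rewrite setID.
have HA := subsetP (barren_sub G A).
pose g x := marginal f A x * marginal f (A :\: H) x -
  marginal f (A :\: H1) x * marginal f (A :\: H2) x.
suff : forall x, g x = 0 by move=> /(_ x)/subr0_eq.
apply: (@alternating0 _ _ H) => [h y hH|y y0]; last first.
  have := markov_equations_at fE anA A0 y0; rewrite /predicted (negbTE Hh) /barren_ratio /g.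
  rewrite -/H -/D -/H1 -/H2 => E.
  have m0 := marginal_neq0 (A :\: H) y f0.
  apply/eqP; rewrite subr_eq0; apply/eqP.
  by rewrite -[marginal f A y](divfK m0) E; field.
have hA := HA _ hH.
have out b B : h \notin B -> marginal f B (set_state h b y) = marginal f B y.
  by move=> hB; apply: marginal_depends; exact: set_state_out.
have hNH : h \notin A :\: H by rewrite inE hH.
have split B : h \in B -> marginal f B (set_state h true y) =
    marginal f (B :\ h) y - marginal f B (set_state h false y).
  by move=> hB; rewrite marginal_split // addrAC subrr add0r.
have cross K1 K2 : K1 \subset H1 -> K2 \subset H2 -> h \notin K1 -> h \notin K2 ->
    marginal f (A :\ h) y * marginal f (A :\ h :\: (K1 :|: K2)) y =
    marginal f (A :\ h :\: K1) y * marginal f (A :\ h :\: K2) y.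
  move=> K1H K2H hK1 hK2.
  have sub K : K \subset H -> h \notin K -> K \subset A :\ h.
    by move=> KH hK; rewrite subsetD1 hK andbT; exact: subset_trans KH (barren_sub G A).
  apply: (cross_independent (A := A) (v := v)) => //.
  - exact: subsetDl.
  - by rewrite -ED.
  - by rewrite -ED.
  - by apply: sub => //; apply: subset_trans K1H (subsetIl _ _).
  - by apply: sub => //; apply: subset_trans K2H (subsetDl _ _).
  exact: IH.
rewrite /g !(out _ _ hNH) (split A) //.
have mem := (in_setD, in_setU, in_setI, in_set1).
have [hD|hD] := boolP (h \in D).
  have h2 : h \in A :\: H2 by rewrite !mem hD.
  have hN1 : h \notin A :\: H1 by rewrite !mem hH hD.
  rewrite !(out _ _ hN1) (split _ h2).
  have := cross (H1 :\ h) H2 (subsetDl _ _) (subxx _).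
  have -> : A :\ h :\: (H1 :\ h :|: H2) = A :\: H.
    apply/setP => u; rewrite !mem; case: eqVneq => [->|_] /=.
      by rewrite hH andbF.
    by case: (u \in D); case: (u \in H).
  have -> : A :\ h :\: (H1 :\ h) = A :\: H1.
    by apply/setP => u; rewrite !mem; case: eqVneq => // ->; rewrite hH hD.
  have -> : A :\ h :\: H2 = A :\: H2 :\ h by rewrite !setDDl setUC.
  rewrite !mem eqxx hD => /(_ isT isT) E.
  by rewrite mulrBl mulrBr E; ring.
have h1 : h \in A :\: H1 by rewrite !mem negb_and hD orbT.
have hN2 : h \notin A :\: H2 by rewrite !mem hD hH.
rewrite !(out _ _ hN2) (split _ h1).
have := cross H1 (H2 :\ h) (subxx _) (subsetDl _ _).
have -> : A :\ h :\: (H1 :|: H2 :\ h) = A :\: H.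
  apply/setP => u; rewrite !mem; case: eqVneq => [->|_] /=.
    by rewrite hH andbF.
  by case: (u \in D); case: (u \in H).
have -> : A :\ h :\: (H2 :\ h) = A :\: H2.
  apply/setP => u; rewrite !mem; case: eqVneq => // ->.
  by rewrite hH (negbTE hD).
have -> : A :\ h :\: H1 = A :\: H1 :\ h by rewrite !setDDl setUC.
rewrite !mem eqxx (negbTE hD) andbF => /(_ isT isT) E.
by rewrite !mulrBl E; ring.
Qed.

(** Either the barren vertices form a head, and the marginal on the others is
    multiplied by a function of the scope of the head, or the marginal on [A] is
    expressed by three smaller ones. *)
Lemma marginal_district_product A : markov_equations f -> ancestral G A ->
  district_product A (marginal f A).
Proof.
move=> fE; have [n] := ubnP #|A|; elim: n A => // n IH A; rewrite ltnS => le_n anA.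
have [->|A0] := eqVneq A set0.
  by apply: product_const; exact: marginal_depends.
have IHK K : K \subset barren G A -> K != set0 ->
    district_product (A :\: K) (marginal f (A :\: K)).
  move=> KB /set0Pn[k kK]; apply: IH; last exact: ancestralD.
  apply: leq_trans le_n; apply: proper_card; apply/properP; split.
    exact: subsetDl.
  by exists k; [apply: (subsetP (barren_sub G A)); exact: (subsetP KB) | rewrite inE kK].
have IH1 h : h \in barren G A -> district_product (A :\ h) (marginal f (A :\ h)).
  by move=> hB; apply: IHK; rewrite ?sub1set //; apply/set0Pn; exists h; rewrite inE.
have [h hB ED] := chosen_districtP anA A0.
have dA K : K \subset barren G A -> K != set0 ->
    district_product A (marginal f (A :\: K)).
  by move=> KB K0; apply: district_productS (subsetDl _ K) (IHK K KB K0).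
have dH : district_product A (marginal f (A :\: barren G A)).
  exact: dA (subxx _) (barren_neq0 anA A0).
have [Hh|Hh] := boolP (barren G A \in heads G).
  have [v vA rv] := head_ratio_depends anA Hh fE IH1.
  have -> : marginal f A = fun x => barren_ratio f A x * marginal f (A :\: barren G A) x.
    by apply: funext => x; rewrite divfK // marginal_neq0.
  by apply: productM dH; exact: product_scope rv.
have H1 : barren G A :&: chosen_district A != set0.
  by apply/set0Pn; exists h; rewrite inE hB ED dis_refl // (subsetP (barren_sub G A)).
have H2 : barren G A :\: chosen_district A != set0.
  by apply: contra Hh; rewrite setD_eq0 ED (is_head_barrenE anA hB).
pose m1 := marginal f (A :\: (barren G A :&: chosen_district A)).
pose m2 := marginal f (A :\: (barren G A :\: chosen_district A)).
have -> : marginal f A = fun x => m1 x * m2 x * (marginal f (A :\: barren G A) x)^-1.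
  apply: funext => x; rewrite /m1 /m2 -(nonhead_independent x anA A0 Hh fE IH1).
  by rewrite mulfK // marginal_neq0.
apply: productM; last exact: productV.
by apply: productM; apply: dA => //; rewrite ?subsetIl ?subsetDl.
Qed.

End Positive.
End Factorization.

(** * The global Markov property as a system of equations *)

Section MarkovEquations.
Import fintype boot.finset.
Variables (R : realType) (V : finType) (G : admg V).
Implicit Types (A B C H K : {set V}) (v h : V) (x y z : states V).

Lemma marginalE (f : states V -> R) B x :
  marginal f B x = \sum_(y | agree B x y) f y.
Proof. by rewrite /marginal /sumout setCK. Qed.

Definition restrict A x : config A := [ffun u => x (val u)].

Lemma ev_restrict A x : ev (restrict A x) =1 agree A x.
Proof.
move=> y; apply/forallP/agreeP => [h v vA|h [v vA]].
  by have := h (exist _ v vA); rewrite ffunE => /eqP->.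
by rewrite ffunE /= h.
Qed.

Lemma restrict_glue A B C (xA : config A) (xB : config B) (xC : config C) :
  [disjoint A & B] -> [disjoint A & C] -> [disjoint B & C] ->
  exists x, [/\ xA = restrict A x, xB = restrict B x & xC = restrict C x].
Proof.
move=> AB AC BC.
pose get K (xK : config K) v := if insub v is Some u then xK u else false.
have getE K (xK : config K) u : get K xK (val u) = xK u by rewrite /get valK.
exists [ffun v => if v \in A then get A xA v
                  else if v \in B then get B xB v else get C xC v].
split; apply/ffunP => u; rewrite !ffunE; have := valP u => uK.
- by rewrite uK getE.
- by rewrite (disjointFl AB uK) uK getE.
by rewrite (disjointFl AC uK) (disjointFl BC uK) getE.
Qed.

Lemma agreeU A B x y : agree (A :|: B) x y = agree A x y && agree B x y.
Proof.
apply/agreeP/andP => [xy|[/agreeP xy /agreeP xy'] v].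
  by split; apply/agreeP => v vX; apply: xy; rewrite inE vX ?orbT.
by rewrite inE => /orP[/xy|/xy'].
Qed.

Section Law.
Variable p : 'rV[R]_#|{: states V}|.
Hypothesis p0 : forall x, 0 < mass p x.
Let f := mass p.

Lemma cprob_restrict A B x :
  cprob p (ev (restrict A x)) (ev (restrict B x)) =
  marginal f (A :|: B) x / marginal f B x.
Proof.
rewrite /cprob /prob !marginalE; congr (_ / _); apply: eq_bigl => y.
  by rewrite /= agreeU -!ev_restrict.
by rewrite ev_restrict.
Qed.

Lemma cond_indepP A B C :
  [disjoint A & B] -> [disjoint A & C] -> [disjoint B & C] ->
  cond_indep p A B C <->
  forall x, marginal f (A :|: B :|: C) x * marginal f C x =
            marginal f (A :|: C) x * marginal f (B :|: C) x.
Proof.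
move=> AB AC BC.
have E x : cprob p [predI ev (restrict A x) & ev (restrict B x)] (ev (restrict C x)) =
    marginal f (A :|: B :|: C) x / marginal f C x.
  rewrite -cprob_restrict /cprob /prob; congr (_ / _); apply: eq_bigl => y.
  have Eab : ev (restrict (A :|: B) x) y = ev (restrict A x) y && ev (restrict B x) y.
    by rewrite !ev_restrict agreeU.
  exact: (congr1 (fun b => b && ev (restrict C x) y) (esym Eab)).
split=> [ci x|ci xA xB xC].
  have := ci (restrict A x) (restrict B x) (restrict C x).
  rewrite E !cprob_restrict => /(canRL (mulfVK (marginal_neq0 C x p0)))->.
  have m0 := marginal_neq0 C x p0.
  by field.
have [x [-> -> ->]] := restrict_glue xA xB xC AB AC BC.
rewrite E !cprob_restrict mulf_div -ci -mulf_div divff ?mulr1 //.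
exact: marginal_neq0.
Qed.

(** The ancestral set generated by the three sets is cut by m-separation so that
    each scope lies on one side; its marginal factorizes accordingly, and this
    survives summing out the vertices that do not occur. *)
Lemma district_products_markov :
  (forall A, ancestral G A -> district_product G A (marginal f A)) ->
  global_markov G p.
Proof.
move=> dp A B C AB AC BC _ _ sep; apply/cond_indepP => // x.
set N := A :|: B :|: C; set D := an G N.
have [S [AS BS SD dS]] := msep_scopes AC sep; rewrite -/N -/D in SD dS.
pose mem := (in_setD, in_setU, in_setI, in_setC).
pose T := D :\: C :\: S.
have ND : N \subset D by exact: sub_an.
have BT : B \subset T.
  apply/subsetP => v vB; rewrite !mem (disjointFr BS vB) (disjointFr BC vB) /=.
  by apply: (subsetP ND); rewrite !mem vB orbT.
have [|F1 [F2 [d1 d2 E]]] := district_product_split (K1 := S) (K2 := T) _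
    (dp D (an_ancestral _ _)).
  move=> u; have [|/subsetP uS] := dS u; [by left | right].
  apply/pred0P => v /=; apply/negP => /andP[/uS]; rewrite !mem.
  by case/orP=> ->; rewrite ?andbF.
have outT : (D :\: N) :\: S \subset T.
  by apply/subsetP => v; rewrite !mem !negb_or => /and3P[-> /andP[_ ->] ->].
have dF2 : depends (sumout (D :\: N :\: S) F2) (~: S).
  exact: dependsW (subsetDl _ _) (sumout_depends d2).
have EN y : marginal f N y =
    sumout ((D :\: N) :&: S) F1 y * sumout (D :\: N :\: S) F2 y.
  have END : D :\: (D :\: N) = N by rewrite setDDr setDv set0U; apply/setIidPr.
  rewrite -[in LHS]END.
  rewrite marginalD ?subsetDl // -[X in sumout X _ _](setID _ S) -sumout_sumout.
    rewrite (eq_sumout _ (g := fun y => F1 y * sumout (D :\: N :\: S) F2 y)).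
      by rewrite sumoutM //; apply: dependsW dF2; rewrite setCS subsetIr.
    move=> z; rewrite (eq_sumout _ E) mulrC -sumoutM.
      by apply: eq_sumout => w; rewrite mulrC.
    by apply: dependsW d1; rewrite setCS.
  by apply/pred0P => v; rewrite /= !mem; case: (v \in S); rewrite ?andbF.
have dF1 : depends (sumout ((D :\: N) :&: S) F1) (~: B).
  apply: dependsW (subset_trans (subsetDl _ _) _) (sumout_depends d1).
  by rewrite setCS.
have := marginal_independent (K1 := A) (K2 := B) x _ _ AB EN dF1.
have -> : N :\: (A :|: B) = C.
  apply/setP => v; rewrite !mem.
  case vC: (v \in C); rewrite ?(disjointFl AC vC) ?(disjointFl BC vC) ?orbT //.
  by rewrite orbF; case: (_ || _).
have -> : N :\: A = B :|: C.
  apply/setP => v; rewrite !mem.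
  case vA: (v \in A); rewrite ?(disjointFr AC vA) ?(disjointFr AB vA) //.
have -> : N :\: B = A :|: C.
  apply/setP => v; rewrite !mem.
  case vB: (v \in B); rewrite ?(disjointFr BC vB) ?(disjointFl AB vB) //=.
  by rewrite orbF.
move=> ->.
- by rewrite mulrC.
- by rewrite /N -setUA subsetUl.
- by rewrite /N setUAC subsetUr.
by apply: dependsW dF2; rewrite setCS.
Qed.

Lemma global_markov_of_equations : markov_equations G f -> global_markov G p.
Proof.
by move=> fE; apply: district_products_markov => A; exact: marginal_district_product.
Qed.

Section Markov.
Hypothesis pG : global_markov G p.

(** The barren vertices of a district are independent of the vertices outside
    the scope given the rest of the scope. *)
Lemma markov_scope A v x : ancestral G A ->
  let H := barren G A :&: dis G A [set v] in H != set0 ->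
  marginal f A x / marginal f (A :\: H) x =
  marginal f (scope G A v) x / marginal f (scope G A v :\: H) x.
Proof.
move=> anA H H0; set W := scope G A v.
have WA : W \subset A by exact: scope_sub.
have HW : H \subset W.
  by apply: subset_trans (subsetUl _ _); exact: subsetIr.
have [AW|/set0Pn AW] := eqVneq (A :\: W) set0.
  suff -> : W = A by [].
  by apply/eqP; rewrite eqEsubset WA -setD_eq0 AW eqxx.
have d1 : [disjoint H & A :\: W].
  by rewrite disjoints_subset; apply: subset_trans HW _; rewrite setCD subsetUr.
have d2 : [disjoint H & W :\: H].
  by rewrite disjoints_subset setCD subsetUr.
have d3 : [disjoint A :\: W & W :\: H].
  by rewrite disjoints_subset setCD setDE; apply: subset_trans (subsetIr _ _) (subsetUl _ _).
have /cond_indepP : cond_indep p H (A :\: W) (W :\: H).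
  by apply: pG => //; [apply/set0Pn | exact: msep_scope].
move=> /(_ d1 d2 d3 x).
have -> : H :|: (A :\: W) :|: (W :\: H) = A.
  apply/setP => u; rewrite !in_setU !in_setD.
  move: (introT implyP (subsetP HW u)) (introT implyP (subsetP WA u)).
  by case: (u \in H); case: (u \in W); case: (u \in A).
have -> : H :|: (W :\: H) = W.
  apply/setP => u; rewrite in_setU in_setD; move: (subsetP HW u).
  by case: (u \in H) => //= /(_ isT)->.
have -> : (A :\: W) :|: (W :\: H) = A :\: H.
  apply/setP => u; rewrite !in_setU !in_setD.
  move: (introT implyP (subsetP HW u)) (introT implyP (subsetP WA u)).
  by case: (u \in H); case: (u \in W); case: (u \in A).
move=> E; apply/eqP; rewrite eqr_div ?marginal_neq0 // E.
by rewrite mulrC.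
Qed.

Lemma scope_ratio_depends A v H :
  depends (fun x => marginal f (scope G A v) x / marginal f (scope G A v :\: H) x)
    (scope G A v).
Proof.
move=> x y xy; congr (_ / _); first exact: marginal_depends.
by apply: (dependsW (subsetDl _ _) (@marginal_depends R V f _)).
Qed.

Lemma markov_head A x : ancestral G A -> barren G A \in heads G ->
  barren_ratio G f A x = marginal f (barren G A :|: tail G (barren G A)) x /
                  marginal f (tail G (barren G A)) x.
Proof.
move=> anA Hh; have [v vH] := set0Pn _ (head_neq0 Hh).
have [hd _] := head_dis Hh vH; rewrite an_barren // in hd.
have [-> ->] := head_tailE Hh vH; rewrite an_barren //.
have HE : barren G A :&: dis G A [set v] = barren G A by apply/setIidPl.
have /= := markov_scope (v := v) x anA; rewrite HE => <- //.
exact: head_neq0 Hh.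
Qed.

Lemma equations_of_global_markov : markov_equations G f.
Proof.
move=> z z0; set A := anset G z; set x := tailstate G z.
have anA : ancestral G A by exact: anset_ancestral.
rewrite /predicted; set H := barren G A; set D := chosen_district G A.
have [Hh|Hh] := ifPn.
  have [v vH] := set0Pn _ (head_neq0 Hh).
  have [EW ET] := head_tailE Hh vH.
  rewrite !markov_head // EW ET; apply: scope_ratio_depends => u uW.
  by rewrite zeroedE in_setC uW.
have A0 : A != set0.
  have /existsP[v zv] : [exists v, z v].
    apply: contraR z0 => /existsPn z0; apply/eqP/ffunP => v; rewrite ffunE.
    exact/negbTE/z0.
  apply/set0Pn; exists v; apply: (subsetP (sub_an _ _)).
  by rewrite inE.
have [v vH ED] := chosen_districtP anA A0.
have H1 : H :&: D != set0.
  apply/set0Pn; exists v; rewrite in_setI vH /D ED dis_refl //.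
  exact: (subsetP (barren_sub G A)).
have key y := markov_scope (v := v) y anA; rewrite /= -ED -/H -/D in key.
have dW := @scope_ratio_depends A v (H :&: D).
set r := (fun y => _) in dW.
have {}key y : marginal f A y = r y * marginal f (A :\: (H :&: D)) y.
  by rewrite /r -key // divfK // marginal_neq0.
have HA : H \subset A by exact: barren_sub.
have E2 : marginal f (A :\: (H :\: D)) x = r x * marginal f (A :\: H) x.
  have H2A : H :\: D \subset A by apply: subset_trans HA; exact: subsetDl.
  rewrite marginalD // (eq_sumout _ key).
  under eq_sumout do rewrite mulrC.
  rewrite sumoutM; last first.
    apply: dependsW dW; rewrite -disjoints_subset disjoint_sym.
    apply/pred0P => u /=; apply/negP => /andP[]; rewrite in_setD => /andP[uD uH].
    by rewrite scope_barren // -ED => uD'; rewrite uD' in uD.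
  rewrite mulrC; congr (_ * _); rewrite -marginalD ?setDDl ?setID //.
  apply/subsetP => u; rewrite !in_setD in_setI => /andP[uD uH].
  by rewrite (negbTE uD) andbF (subsetP HA).
rewrite /barren_ratio key E2 -/H; set a := marginal f (A :\: (H :&: D)) x.
have m0 : marginal f (A :\: H) x != 0 by exact: marginal_neq0.
by field.
Qed.

End Markov.
End Law.
End MarkovEquations.

(** * Smooth functions of several variables *)

Section SmoothCalculus.
Local Open Scope classical_set_scope.
Variable R : realType.

(** Differentiability carries over between functions that agree near a point,
    since their difference is of this kind. *)
Lemma differentiable_near0 (V W : normedModType R) (h : V -> W) x :
  (\near x, h x = 0) -> differentiable h x.
Proof.
move=> h0; have hx : h x = 0 by exact: nbhs_singleton h0.
have E : h \o shift x = cst (h x) + \0 +o_ (0 : V) id.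
  apply/eqaddoP => e e0; rewrite hx.
  have : \forall y \near (0 : V), h (y + x) = 0.
    by rewrite (near_shift x) /=; near=> y; rewrite /= sub0r subrK; near: y.
  apply: filterS => y /= Ey; rewrite !fctE /= Ey !addr0 subr0 normr0.
  by rewrite mulr_ge0 // ltW.
have c0 : continuous (\0 : V -> W) by move=> ?; exact: cvg_cst.
by apply/diff_locallyP; rewrite (diff_unique (df := \0) c0 E).
Unshelve. all: by end_near. Qed.

(** The scalar version of [Ck]; a map into ['rV_n] is handled through its
    coordinates. *)
Fixpoint scalarCk (k : nat) m (U : set 'rV[R]_m) (f : 'rV[R]_m -> R) : Prop :=
  if k is k'.+1 then
    (forall x, U x -> differentiable f x) /\
    (forall v, scalarCk k' U (fun x => 'D_v f x))
  else forall x, U x -> {for x, continuous f}.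

Definition scalar_smooth m (U : set 'rV[R]_m) (f : 'rV[R]_m -> R) :=
  forall k, scalarCk k U f.

Section Rules.
Variables (m : nat) (U : set 'rV[R]_m).
Hypothesis oU : open U.
Implicit Types (f g : 'rV[R]_m -> R).

Lemma near_eq_on T (f g : 'rV[R]_m -> T) x : {in U, f =1 g} -> U x ->
  \near x, f x = g x.
Proof.
move=> fg Ux; near=> y; apply: fg; rewrite inE.
by near: y; exact: open_nbhs_nbhs.
Unshelve. all: by end_near. Qed.

Lemma differentiable_ext (W : normedModType R) (f g : 'rV[R]_m -> W) x :
  {in U, f =1 g} -> U x -> differentiable f x -> differentiable g x.
Proof.
move=> fg Ux df; have -> : g = f + (g - f) by rewrite addrC subrK.
apply: differentiableD => //; apply: differentiable_near0.
apply: (@near_eq_on _ (g - f) (cst 0)) => // y yU.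
by rewrite !fctE fg // subrr.
Qed.

Lemma scalarCk_ext k f g : {in U, f =1 g} -> scalarCk k U f -> scalarCk k U g.
Proof.
elim: k f g => [|k IH] f g fg /=.
  move=> cf x Ux; rewrite /prop_for /continuous_at -fg ?inE //.
  exact: cvg_trans (near_eq_cvg (near_eq_on fg Ux)) (cf x Ux).
case=> df Df; split=> [x Ux|v]; first exact: differentiable_ext (df x Ux).
apply: IH (Df v) => x; rewrite inE => Ux.
by apply: near_eq_derive; exact: near_eq_on.
Qed.

Lemma scalarCkS k f : scalarCk k.+1 U f -> scalarCk k U f.
Proof.
elim: k f => [|k IH] f.
  by case=> df _ x Ux; exact: differentiable_continuous (df x Ux).
by case=> df Df; split=> // v; exact: IH (Df v).
Qed.

Lemma scalar_smooth_ext f g :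
  {in U, f =1 g} -> scalar_smooth U f -> scalar_smooth U g.
Proof. by move=> fg sf k; exact: scalarCk_ext (sf k). Qed.

Lemma scalarCk_cst k c : scalarCk k U (fun=> c).
Proof.
elim: k c => [|k IH] c; first by move=> x _; exact: cst_continuous.
split=> [x _|v]; first exact: differentiable_cst.
by apply: scalarCk_ext (IH 0) => x _; rewrite derive_cst.
Qed.

Lemma scalarCk_coord k i : scalarCk k U (fun x => x 0 i).
Proof.
case: k => [|k]; first by move=> x _; exact: coord_continuous.
split=> [x _|v]; first exact: differentiable_coord.
apply: scalarCk_ext (scalarCk_cst k (v 0 i)) => x _.
have := @derive_mx R 'rV[R]_m 1 m id x v (@derivable_id _ _ _ _).
by rewrite derive_id => /rowP/(_ i); rewrite mxE.
Qed.

Lemma scalarCkD k f g : scalarCk k U f -> scalarCk k U g ->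
  scalarCk k U (fun x => f x + g x).
Proof.
elim: k f g => [|k IH] f g /=.
  by move=> cf cg x Ux; apply: continuousD; [exact: cf | exact: cg].
case=> df Df [dg Dg]; split=> [x Ux|v].
  by apply: differentiableD; [exact: df | exact: dg].
apply: scalarCk_ext (IH _ _ (Df v) (Dg v)) => x; rewrite inE => Ux.
by rewrite [RHS]deriveD //; apply: diff_derivable; [exact: df | exact: dg].
Qed.

Lemma scalarCkM k f g : scalarCk k U f -> scalarCk k U g ->
  scalarCk k U (fun x => f x * g x).
Proof.
elim: k f g => [|k IH] f g.
  by move=> cf cg x Ux; apply: continuousM; [exact: cf | exact: cg].
move=> kf kg; have [df Df] := kf; have [dg Dg] := kg; split=> [x Ux|v].
  by apply: differentiableM; [exact: df | exact: dg].
apply: scalarCk_ext (scalarCkD (IH _ _ (scalarCkS kf) (Dg v))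
                               (IH _ _ (scalarCkS kg) (Df v))) => x.
rewrite inE => Ux.
by rewrite [RHS]deriveM //; apply: diff_derivable; [exact: df | exact: dg].
Qed.

Lemma scalarCk_sum k (I : Type) (r : seq I) (P : pred I) (F : I -> 'rV[R]_m -> R) :
  (forall i, P i -> scalarCk k U (F i)) ->
  scalarCk k U (fun x => \sum_(i <- r | P i) F i x).
Proof.
move=> kF; elim: r => [|i r IH].
  by apply: scalarCk_ext (scalarCk_cst k 0) => x _; rewrite big_nil.
have [Pi|Pi] := boolP (P i).
  apply: scalarCk_ext (scalarCkD (kF _ Pi) IH) => x _.
  by rewrite big_cons Pi.
by apply: scalarCk_ext IH => x _; rewrite big_cons (negbTE Pi).
Qed.

Lemma scalarCkV k f : (forall x, U x -> f x != 0) -> scalarCk k U f ->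
  scalarCk k U (fun x => (f x)^-1).
Proof.
move=> f0; elim: k => [|k IH] kf.
  by move=> x Ux; apply: continuousV; [exact: f0 | exact: kf].
have [df Df] := kf; split=> [x Ux|v].
  by apply: differentiableV; [exact: df | exact: f0].
have kV := IH (scalarCkS kf).
apply: scalarCk_ext (scalarCkM (scalarCk_cst k (-1))
  (scalarCkM (scalarCkM kV kV) (Df v))) => x; rewrite inE => Ux.
rewrite [RHS]deriveV ?f0 //; last by apply: diff_derivable; exact: df.
by rewrite mulN1r -[RHS]/(_ * _) mulNr expr2 invfM.
Qed.

Lemma derive_outer (phi : R -> R) f x v d : is_derive (f x) 1 phi d ->
  differentiable f x ->
  differentiable (phi \o f) x /\ 'D_v (phi \o f) x = d * 'D_v f x.
Proof.
move=> [phi1 phid] df; have dphi : differentiable phi (f x) by apply/derivable1_diffP.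
have dc := differentiable_comp df dphi; split=> //.
rewrite !deriveE // diff_comp //= -phid deriveE // -[X in 'd phi _ X]mulr1.
by rewrite [LHS]linearZ mulrC.
Qed.

Lemma scalarCk_exp k f : scalarCk k U f -> scalarCk k U (fun x => expR (f x)).
Proof.
elim: k => [|k IH] kf.
  by move=> x Ux; apply: continuous_comp; [exact: kf | exact: continuous_expR].
have [df Df] := kf; have d x v Ux := derive_outer v (is_derive_expR (f x)) (df x Ux).
split=> [x Ux|v]; first by case: (d x 0 Ux).
apply: scalarCk_ext (scalarCkM (IH (scalarCkS kf)) (Df v)) => x.
by rewrite inE => Ux; case: (d x v Ux).
Qed.

Lemma scalarCk_ln k f : (forall x, U x -> 0 < f x) -> scalarCk k U f ->
  scalarCk k U (fun x => ln (f x)).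
Proof.
move=> f0; case: k => [|k] kf.
  by move=> x Ux; apply: continuous_comp; [exact: kf | exact/continuous_ln/f0].
have [df Df] := kf.
have d x v Ux := derive_outer v (is_derive1_ln (f0 x Ux)) (df x Ux).
split=> [x Ux|v]; first by case: (d x 0 Ux).
have kV : scalarCk k U (fun x => (f x)^-1).
  by apply: scalarCkV (scalarCkS kf) => x Ux; rewrite gt_eqF ?f0.
apply: scalarCk_ext (scalarCkM kV (Df v)) => x.
by rewrite inE => Ux; case: (d x v Ux).
Qed.

(** A row is the combination of the basis rows with its coordinates. *)
Lemma CkP k n (f : 'rV[R]_m -> 'rV[R]_n) :
  Ck k U f <-> forall i, scalarCk k U (fun x => f x 0 i).
Proof.
elim: k f => [|k IH] f; split.
- move=> cf i x Ux; apply: (@continuous_comp _ _ _ f (fun M : 'rV[R]_n => M 0 i)).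
    exact: cf.
  exact: coord_continuous.
- move=> cf x Ux; have -> : f = \sum_j (fun y => f y 0 j *: delta_mx 0 j : 'rV[R]_n).
    by apply: funext => y; rewrite fct_sumE [LHS]row_sum_delta.
  elim/big_ind: _ => [|g h cg ch|j _]; first exact: cst_continuous.
    exact: continuousD.
  exact: (@continuousZr_tmp _ _ _ (fun y => f y 0 j) _ _ (cf j x Ux)).
- case=> df Df i; split=> [x Ux|v].
    apply: (@differentiable_comp _ _ _ _ f (fun M : 'rV[R]_n => M 0 i : R)).
      exact: df.
    exact: differentiable_coord.
  have /IH/(_ i) := Df v; apply: scalarCk_ext => x; rewrite inE => Ux.
  by rewrite derive_mx ?mxE //; apply: diff_derivable; exact: df.
move=> kf.
have df x : U x -> differentiable f x.
  move=> Ux; have -> : f = \sum_j (fun y => f y 0 j *: delta_mx 0 j : 'rV[R]_n).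
    by apply: funext => y; rewrite fct_sumE [LHS]row_sum_delta.
  apply: differentiable_sum => j; apply: differentiableZl.
  by have [dj _] := kf j; exact: dj.
split=> // v; apply/IH => i; have [_ Di] := kf i.
apply: scalarCk_ext (Di v) => x; rewrite inE => Ux.
by rewrite derive_mx ?mxE //; apply: diff_derivable; exact: df.
Qed.

Lemma smoothP n (f : 'rV[R]_m -> 'rV[R]_n) :
  smooth U f <-> forall i, scalar_smooth U (fun x => f x 0 i).
Proof.
by split=> sf; [move=> i k; move/CkP: (sf k) | move=> k; apply/CkP => i; exact: sf].
Qed.

Lemma smooth_row n (f : 'I_n -> 'rV[R]_m -> R) :
  (forall i, scalar_smooth U (f i)) -> smooth U (fun x => \row_i f i x).
Proof.
move=> sf; apply/smoothP => i; apply: scalar_smooth_ext (sf i) => x _.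
by rewrite mxE.
Qed.

Lemma smooth_continuous n (f : 'rV[R]_m -> 'rV[R]_n) x :
  smooth U f -> U x -> {for x, continuous f}.
Proof. by move=> sf; exact: (sf 0%N). Qed.

Lemma smooth_differentiable n (f : 'rV[R]_m -> 'rV[R]_n) x :
  smooth U f -> U x -> differentiable f x.
Proof. by move=> sf; case: (sf 1%N) => df _; exact: df. Qed.

Lemma open_preimage_in n (f : 'rV[R]_m -> 'rV[R]_n) (W : set 'rV[R]_n) :
  (forall x, U x -> {for x, continuous f}) -> open W -> open (U `&` f @^-1` W).
Proof.
move=> cf oW; rewrite openE => x [Ux Wfx]; apply: filterI.
  exact: open_nbhs_nbhs.
by apply: (cf x Ux); exact: open_nbhs_nbhs.
Qed.

Lemma open_positive (I : finType) (F : I -> 'rV[R]_m -> R) :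
  (forall i, scalar_smooth U (F i)) ->
  open (U `&` [set y | forall i, 0 < F i y]).
Proof.
move=> sF; rewrite openE => y [Uy Fy]; apply: filterI.
  exact: open_nbhs_nbhs.
have Fi i : \forall z \near y, 0 < F i z.
  have /= cF := sF i 0%N y Uy.
  exact: cvgr_gt cF _ (Fy i).
exact: (@filter_forall _ _ (fun i z => 0 < F i z) (nbhs y) _ Fi).
Qed.

End Rules.

Lemma scalarCk_subset m (U U' : set 'rV[R]_m) k (f : 'rV[R]_m -> R) :
  U `<=` U' -> scalarCk k U' f -> scalarCk k U f.
Proof.
move=> UU'; elim: k f => [|k IH] f; first by move=> cf x /UU'; exact: cf.
by case=> df Df; split=> [x /UU'|v]; [exact: df | exact: IH (Df v)].
Qed.

Lemma Ck_subset m n (U U' : set 'rV[R]_m) (f : 'rV[R]_m -> 'rV[R]_n) k :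
  U `<=` U' -> Ck k U' f -> Ck k U f.
Proof.
move=> UU'; elim: k f => [|k IH] f; first by move=> cf x /UU'; exact: cf.
by case=> df Df; split=> [x /UU'|v]; [exact: df | exact: IH (Df v)].
Qed.

(** The derivative of [g] at [f x] is taken in the direction ['D_v f x], which
    moves with [x]; expanding it in the standard basis leaves derivatives of [g]
    in fixed directions, to which induction applies. *)
Lemma scalarCk_comp m n (U : set 'rV[R]_m) (W : set 'rV[R]_n) k
    (f : 'rV[R]_m -> 'rV[R]_n) (g : 'rV[R]_n -> R) :
  open U -> open W -> (forall x, U x -> W (f x)) ->
  Ck k U f -> scalarCk k W g -> scalarCk k U (g \o f).
Proof.
move=> oU oW fUW; elim: k f g fUW => [|k IH] f g fUW.
  by move=> cf cg x Ux; apply: continuous_comp; [exact: cf | exact/cg/fUW].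
move=> kf [dg Dg]; have [df Df] := kf.
have kf' : Ck k U f.
  by apply/(CkP oU) => i; apply: scalarCkS; move/(CkP oU): kf.
split=> [x Ux|v].
  by apply: differentiable_comp; [exact: df | exact/dg/fUW].
have sD i : scalarCk k U (fun x => 'D_v f x 0 i).
  by have /(CkP oU) := Df v.
apply: (scalarCk_ext oU) (scalarCk_sum oU (index_enum _) (P := xpredT) (fun i _ =>
  scalarCkM oU (sD i) (IH _ _ fUW kf' (Dg (delta_mx 0 i))))) => x.
rewrite inE => Ux; have dfx := df x Ux; have dgx := dg _ (fUW x Ux).
rewrite [RHS]deriveE; last exact: differentiable_comp.
rewrite diff_comp //= -(deriveE v dfx).
rewrite [in RHS](row_sum_delta ('D_v f x)) linear_sum /=.
apply: eq_bigr => i _; rewrite linearZ /=; congr (_ * _).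
by rewrite deriveE //; exact/dg/fUW.
Qed.

Lemma scalar_smooth_comp m n (U : set 'rV[R]_m) (W : set 'rV[R]_n)
    (f : 'rV[R]_m -> 'rV[R]_n) (g : 'rV[R]_n -> R) :
  open U -> open W -> (forall x, U x -> W (f x)) ->
  smooth U f -> scalar_smooth W g -> scalar_smooth U (g \o f).
Proof. by move=> oU oW fUW sf sg k; exact: (scalarCk_comp oU oW). Qed.

Lemma smooth_comp m n l (U : set 'rV[R]_m) (W : set 'rV[R]_n)
    (f : 'rV[R]_m -> 'rV[R]_n) (g : 'rV[R]_n -> 'rV[R]_l) :
  open U -> open W -> (forall x, U x -> W (f x)) ->
  smooth U f -> smooth W g -> smooth U (g \o f).
Proof.
move=> oU oW fUW sf /(smoothP oW) sg; apply/(smoothP oU) => i.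
exact: (scalar_smooth_comp oU oW fUW sf (sg i)).
Qed.

Lemma smooth_subset m n (U U' : set 'rV[R]_m) (f : 'rV[R]_m -> 'rV[R]_n) :
  U `<=` U' -> smooth U' f -> smooth U f.
Proof. by move=> UU' sf k; exact: Ck_subset (sf k). Qed.

Lemma smooth_mulmx m n (U : set 'rV[R]_m) (M : 'M[R]_(m, n)) :
  open U -> smooth U (mulmxr M).
Proof.
move=> oU; apply/(smoothP oU) => i k; apply: (scalarCk_ext oU) (scalarCk_sum oU
  (index_enum 'I_m) (P := xpredT) (fun j _ => scalarCkM oU (scalarCk_coord oU k j)
  (scalarCk_cst oU k (M j i)))) => x _.
by rewrite /= mxE.
Qed.

End SmoothCalculus.

(** * Triangular changes of coordinates *)

Section Diffeomorphisms.
Local Open Scope classical_set_scope.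
Variable R : realType.

(** A two-sided inverse, in the form in which inverses are constructed below. *)
Lemma diffeomorphismI N (U W : set 'rV[R]_N) (f g : 'rV[R]_N -> 'rV[R]_N) :
  open U -> open W -> (forall x, U x -> W (f x) /\ g (f x) = x) ->
  (forall y, W y -> U (g y) /\ f (g y) = y) ->
  smooth U f -> smooth W g -> diffeomorphism U W f.
Proof.
move=> oU oW fUW gWU sf sg; split=> //; last by exists g => // x /fUW[].
split=> [x /fUW[]//|x x'|y /gWU[Ugy E]]; last by exists (g y).
by rewrite !inE => /fUW[_ E] /fUW[_ E'] ff; rewrite -E ff E'.
Qed.

Lemma diffeomorphismE N (U W : set 'rV[R]_N) (f : 'rV[R]_N -> 'rV[R]_N) :
  diffeomorphism U W f -> exists g, [/\ smooth W g,
    (forall x, U x -> W (f x) /\ g (f x) = x) &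
    (forall y, W y -> U (g y) /\ f (g y) = y)].
Proof.
case=> _ _ [fUW _ fS] _ [g gK sg]; exists g; split=> // [x Ux|y /fS[x Ux <-]].
  by split; [exact: fUW | exact: gK].
by rewrite gK.
Qed.

(** The image is open as the preimage of [W] under the inverse of [g]. *)
Lemma diffeomorphism_comp N (U W D E : set 'rV[R]_N)
    (f g : 'rV[R]_N -> 'rV[R]_N) :
  diffeomorphism U W f -> diffeomorphism D E g -> W `<=` D ->
  diffeomorphism U (g @` W) (g \o f).
Proof.
move=> df dg WD; have [oU oW _ sf _] := df; have [oD oE _ sg _] := dg.
have [f' [sf' fK f'K]] := diffeomorphismE df.
have [g' [sg' gK g'K]] := diffeomorphismE dg.
have EW : g @` W = E `&` g' @^-1` W.
  apply/seteqP; split=> [y [x Wx <-]|y [Ey Wy]] /=.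
    by have [Egx ->] := gK _ (WD _ Wx).
  by exists (g' y) => //; have [] := g'K _ Ey.
have oE' : open (g @` W).
  by rewrite EW; apply: open_preimage_in => // x Ex; exact: (smooth_continuous sg').
apply: (@diffeomorphismI _ _ _ _ (f' \o g')) => //.
- move=> x /fK[Wfx fxK]; split; first by exists (f x).
  by have [_ /= ->] := gK _ (WD _ Wfx).
- move=> _ [x Wx <-] /=; have [_ ->] := gK _ (WD _ Wx).
  by have [Ux ->] := f'K _ Wx.
- apply: (smooth_comp oU oD _ sf sg) => x /fK[Wfx _]; exact: WD.
apply: (smooth_comp oE' oW _ _ sf').
  by move=> _ [x Wx <-]; have [_ ->] := gK _ (WD _ Wx).
by apply: smooth_subset sg'; rewrite EW => y [].
Qed.

(** Each coordinate is rescaled by [c] and shifted by [b], both functions of the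
    coordinates of lower rank, on the part [D] of the space where [c] does not
    vanish. The inverse solves for one coordinate after the other. *)
Section Triangular.
Variables (N : nat) (rk : 'I_N -> nat) (U : set 'rV[R]_N).
Variables (D : 'I_N -> set 'rV[R]_N) (b c : 'I_N -> 'rV[R]_N -> R).

Hypothesis oU : open U.
Hypothesis UD : forall i, U `<=` D i.
Hypothesis oD : forall i, open (D i).
Hypothesis sb : forall i, scalar_smooth (D i) (b i).
Hypothesis sc : forall i, scalar_smooth (D i) (c i).
Hypothesis c0 : forall i y, D i y -> c i y != 0.
Hypothesis lower : forall i (y y' : 'rV[R]_N),
  (forall j, (rk j < rk i)%N -> y 0 j = y' 0 j) ->
  [/\ D i y -> D i y', b i y = b i y' & c i y = c i y'].

Let F i (y : 'rV[R]_N) := y 0 i / c i y - b i y.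
Let level k (y : 'rV[R]_N) : 'rV[R]_N :=
  \row_i (if rk i == k then F i y else y 0 i).
Let unlevel k (y : 'rV[R]_N) : 'rV[R]_N :=
  \row_i (if rk i == k then (y 0 i + b i y) * c i y else y 0 i).
Let Dk k : set 'rV[R]_N := [set y | forall i, rk i = k -> D i y].

(** The coefficients used at one level are functions of coordinates that the
    level leaves alone. *)
Lemma diffeomorphism_level k : diffeomorphism (Dk k) (Dk k) (level k).
Proof.
have oDk : open (Dk k).
  rewrite openE => y Dy.
  suff: \forall z \near y, forall i, rk i = k -> D i z by [].
  apply: (@filter_forall _ _ (fun i z => rk i = k -> D i z) (nbhs y)) => i.
  have [ik|ik] := eqVneq (rk i) k; last first.
    by apply: nearW => z /eqP; rewrite (negbTE ik).
  have Oi : open (D i) by [].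
  have := open_nbhs_nbhs (conj Oi (Dy i ik)); apply: filterS => z Dz _.
  exact: Dz.
have DkD i : rk i = k -> Dk k `<=` D i by move=> ik y; apply.
have low (g : 'rV[R]_N -> 'rV[R]_N) y i : rk i = k ->
    (forall j, rk j != k -> g y 0 j = y 0 j) ->
    [/\ D i y -> D i (g y), b i (g y) = b i y & c i (g y) = c i y].
  move=> ik gy; have [|Dy <- <-] // := @lower i y (g y).
  by move=> j; rewrite ik => jk; rewrite gy // ltn_eqF.
have lv j y : rk j != k -> level k y 0 j = y 0 j.
  by move=> jk; rewrite mxE (negbTE jk).
have ul j y : rk j != k -> unlevel k y 0 j = y 0 j.
  by move=> jk; rewrite mxE (negbTE jk).
apply: (@diffeomorphismI _ _ _ _ (unlevel k)) => //.
- move=> y Dy; split.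
    by move=> i ik; have [DD _ _] := low (level k) y i ik (fun j => lv j y); exact/DD/Dy.
  apply/rowP => i; rewrite mxE; case: eqP => ik; last by rewrite lv //; apply/eqP.
  have [_ -> ->] := low (level k) y i ik (fun j => lv j y).
  by rewrite mxE ik eqxx /F subrK divfK //; apply: c0; exact: Dy.
- move=> y Dy; split.
    by move=> i ik; have [DD _ _] := low (unlevel k) y i ik (fun j => ul j y); exact/DD/Dy.
  apply/rowP => i; rewrite mxE; case: eqP => ik; last by rewrite ul //; apply/eqP.
  rewrite /F; have [_ -> ->] := low (unlevel k) y i ik (fun j => ul j y).
  by rewrite mxE ik eqxx mulfK ?addrK //; apply: c0; exact: Dy.
- apply: smooth_row => // i; case: eqP => ik; last by move=> l; exact: scalarCk_coord.
  move=> l; have bl := scalarCk_subset (DkD i ik) (sb i l).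
  have cl := scalarCk_subset (DkD i ik) (sc i l).
  apply: (scalarCkD oDk).
    apply: (scalarCkM oDk); first exact: scalarCk_coord.
    by apply: (scalarCkV oDk) => // y Dy; apply: c0; exact: Dy.
  apply: (scalarCk_ext oDk) (scalarCkM oDk (scalarCk_cst oDk l (-1)) bl) => y _.
  by rewrite mulN1r.
apply: smooth_row => // i; case: eqP => ik; last by move=> l; exact: scalarCk_coord.
move=> l; have bl := scalarCk_subset (DkD i ik) (sb i l).
have cl := scalarCk_subset (DkD i ik) (sc i l).
apply: (scalarCkM oDk) => //; apply: (scalarCkD oDk) => //.
exact: scalarCk_coord.
Qed.

(** The coordinates are replaced level by level, the highest first, so that
    each step still sees the original lower coordinates. *)
Lemma diffeomorphism_triangular :
  exists W, diffeomorphism U W (fun y => \row_i (y 0 i / c i y - b i y)).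
Proof.
pose above k (y : 'rV[R]_N) : 'rV[R]_N :=
  \row_i (if (k <= rk i)%N then F i y else y 0 i).
have step k : above k = level k \o above k.+1.
  apply: funext => y; apply/rowP => i; rewrite /= !mxE.
  case: (ltngtP k (rk i)) => // ki; rewrite /F mxE -ki ltnn.
  have [|_ -> ->] // := @lower i y (above k.+1 y) => j.
  by rewrite -ki => jk; rewrite mxE leqNgt (leq_trans jk).
have top : above (\max_i rk i).+1 = id.
  apply: funext => y; apply/rowP => i; rewrite mxE ltnNge.
  by rewrite (@leq_bigmax _ rk i).
suff H j k : (k + j = (\max_i rk i).+1)%N -> exists W, diffeomorphism U W (above k).
  have [W dW] := H _ 0%N (add0n _); exists W; exact: dW.
elim: j k => [|j IH] k.
  rewrite addn0 => ->; rewrite top; exists U.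
  have sid : smooth U id.
    by apply/smoothP => // i l; exact: scalarCk_coord.
  by apply: (@diffeomorphismI _ _ _ _ id).
rewrite addnS -addSn => /IH[W dW]; exists (level k @` W); rewrite step.
apply: diffeomorphism_comp (dW) (diffeomorphism_level k) _.
have [_ _ [_ _ WU] _ _] := dW; move=> _ /WU[y Uy <-] i ik.
have [|DD _ _] := @lower i y (above k.+1 y); last exact/DD/UD.
by move=> l; rewrite ik => lk; rewrite mxE leqNgt (leq_trans lk).
Qed.

End Triangular.
End Diffeomorphisms.

(** * The parameters of the saturated model *)

(** The chart has to list the parameters of the model before the other
    coordinates. *)
Lemma enum_extending (T T' : finType) (phi : T -> T') : injective phi ->
  (#|T| <= #|T'|)%N /\ exists2 zeta : 'I_#|T'| -> T', bijective zeta &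
    forall (i : 'I_#|T|) (j : 'I_#|T'|), i = j :> nat -> zeta j = phi (enum_val i).
Proof.
move=> inj_phi; split; first exact: fintype.leq_card inj_phi.
pose L := map phi (enum T) ++ [seq z <- enum T' | z \notin map phi (enum T)].
have uL : uniq L.
  rewrite cat_uniq map_inj_uniq // enum_uniq filter_uniq ?enum_uniq //= andbT.
  by apply/hasPn => z; rewrite mem_filter => /andP[].
have mL z : z \in L.
  by rewrite mem_cat mem_filter mem_enum andbT; exact: orbN.
have sL : size L == #|T'|.
  rewrite cardT; apply/eqP/perm_size/uniq_perm; rewrite ?enum_uniq // => z.
  by rewrite mL mem_enum.
exists (tnth (Tuple sL)) => [|i j ij].
  apply: inj_card_bij; last by rewrite card_ord.
  exact/tuple_uniqP.
have iT : (i < size (enum T))%N by rewrite -cardE.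
rewrite (tnth_nth (phi (enum_val i))) /= nth_cat size_map -ij iT.
rewrite (nth_map (enum_val i)) //; congr phi.
exact/esym/enum_val_nth.
Qed.

Section Coordinates.
Import fintype boot.finset.
Variables (R : realType) (V : finType) (G : admg V).
Implicit Types (A B H K : {set V}) (v h : V) (x y z : states V)
  (f g : states V -> R).

Definition moment f z := marginal f (anset G z) (tailstate G z).

(** At states vanishing on the barren vertices of [B] the marginal is a moment;
    at other states it is a difference of marginals with a barren vertex removed
    or put at 0. *)
Lemma moment_marginal f g B : ancestral G B ->
  (forall z, anset G z \subset B -> moment f z = moment g z) ->
  marginal f B =1 marginal g B.
Proof.
have [n] := ubnP #|B|; elim: n B => // n IH B; rewrite ltnS => le_n anB fg x.
apply: subr0_eq; move: x; apply: (@alternating0 _ _ (barren G B)) => [h x hB|x x0].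
  have hB' := subsetP (barren_sub G B) _ hB.
  rewrite addrACA -opprD -!marginal_split // (IH (B :\ h)) ?subrr //.
  - by apply: leq_trans le_n; rewrite [X in (_ < X)%N](cardsD1 h) hB'.
  - by apply: ancestralD; rewrite ?sub1set.
  by move=> z zB; apply: fg; apply: subset_trans zB (subsetDl _ _).
have := fg (cell G B x); rewrite /moment anset_cell // => /(_ (subxx _)).
have Ex := tailstate_cell anB x0.
by rewrite !(@marginal_depends _ _ _ B _ _ Ex) => ->; rewrite subrr.
Qed.

Lemma supp_barren z : barren G (anset G z) \subset supp z.
Proof.
apply/subsetP => h /(barrenP _ (anset_ancestral G z))[/mem_an[v vz]].
case/connectP=> -[|u s] /=; first by move=> _ <-.
case/andP=> hu us Ev /(_ _ hu)/negP[]; apply/mem_an; exists v => //.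
by apply/connectP; exists s.
Qed.

Lemma tailstate0 z h : h \in barren G (anset G z) -> tailstate G z h = false.
Proof. by move=> hB; rewrite zeroedE hB. Qed.

Lemma tailstate_out z h : h \notin barren G (anset G z) -> tailstate G z h = z h.
Proof. by move=> hB; rewrite zeroedE hB. Qed.

Lemma anset_neq0 z : z != zero_state V -> anset G z != set0.
Proof.
apply: contra => /eqP A0; apply/eqP/ffunP => v; rewrite ffunE.
apply/negbTE/negP => zv; suff : v \in anset G z by rewrite A0 inE.
by apply: (subsetP (sub_an _ _)); rewrite inE.
Qed.

Lemma anset0 : anset G (zero_state V) = set0.
Proof.
by apply/setP => v; rewrite [RHS]inE; apply/negP => /mem_an[w]; rewrite inE ffunE.
Qed.

(** The states that stand for a parameter of the model, as opposed to one that
    the Markov equations determine. *)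
Definition free z := let H := barren G (anset G z) in
  (H \in heads G) && (supp z \subset H :|: tail G H).

Lemma predicted_free f z : free z ->
  predicted G f (anset G z) (tailstate G z) =
  barren_ratio G f (anset G z) (tailstate G z).
Proof.
move=> /andP[Hh zHT]; rewrite /predicted Hh; apply: barren_ratio_depends => v vA.
rewrite zeroedE in_setC negbK; case: (boolP (v \in _)) => //= vN.
rewrite tailstate_out; last by move: vN; rewrite in_setU negb_or => /andP[].
by apply/esym/negbTE; apply: contra vN => zv; apply: (subsetP zHT); rewrite inE.
Qed.

(** A prediction involves smaller ancestral sets or, for the same ancestral set,
    smaller supports; the factor [#|V|.+1] makes the first comparison win. *)
Definition depth z := (#|anset G z| * #|V|.+1 + #|supp z|)%N.

Lemma depth_proper z z' : anset G z' \proper anset G z -> (depth z' < depth z)%N.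
Proof.
move=> /proper_card lt; apply: (@leq_trans ((#|anset G z'|).+1 * #|V|.+1)).
  by rewrite /depth mulSn addnC ltn_add2r ltnS max_card.
by apply: leq_trans (leq_addr _ _); rewrite leq_mul2r lt orbT.
Qed.

Lemma moment_marginal_proper f g z B : ancestral G B -> B \proper anset G z ->
  (forall z', (depth z' < depth z)%N -> moment f z' = moment g z') ->
  marginal f B =1 marginal g B.
Proof.
move=> anB Bz fg; apply: moment_marginal => // z' z'B; apply: fg.
by apply: depth_proper; exact: sub_proper_trans z'B Bz.
Qed.

Lemma properD1_barren A K : K \subset barren G A -> K != set0 -> A :\: K \proper A.
Proof.
move=> KB /set0Pn[k kK]; apply/properP; split; first exact: subsetDl.
exists k; last by rewrite inE kK.
exact: (subsetP (barren_sub G A)) _ (subsetP KB _ kK).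
Qed.

Lemma predicted_lower f g z : z != zero_state V -> ~~ free z ->
  (forall z', (depth z' < depth z)%N -> moment f z' = moment g z') ->
  predicted G f (anset G z) (tailstate G z) =
  predicted G g (anset G z) (tailstate G z).
Proof.
move=> z0 nfz fg; rewrite /predicted; set A := anset G z; set H := barren G A.
have anA : ancestral G A := anset_ancestral G z.
have A0 := anset_neq0 z0; have B0 := barren_neq0 anA A0.
have mE K : K \subset H -> K != set0 -> marginal f (A :\: K) =1 marginal g (A :\: K).
  move=> KH K0; apply: (moment_marginal_proper (z := z)) fg.
    exact: ancestralD.
  exact: properD1_barren.
have [Hh|Hh] := ifPn; last first.
  have [v vH ED] := chosen_districtP anA A0.
  rewrite !mE // ?subsetIl ?subsetDl //.
    by apply: contra Hh; rewrite setD_eq0 ED /H (is_head_barrenE anA vH).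
  apply/set0Pn; exists v; rewrite in_setI vH ED dis_refl //.
  exact: (subsetP (barren_sub G A)).
rewrite /barren_ratio mE //; congr (_ / _).
set x0 := zeroed _ _; have x0H h : h \in H -> x0 h = false.
  by move=> hH; rewrite /x0 zeroedE tailstate0 ?andbF.
have Ex := tailstate_cell anA x0H.
have mc k : marginal k A x0 = moment k (cell G A x0).
  by rewrite /moment anset_cell // (@marginal_depends _ _ _ A _ _ Ex).
rewrite !mc fg // /depth anset_cell // ltn_add2l; apply: proper_card.
apply/properP; split.
  apply/subsetP => v; rewrite inE ffunE -/H => /orP[|/andP[vA]].
    exact: (subsetP (supp_barren z)).
  by rewrite /x0 zeroedE /tailstate zeroedE => /and3P[_ _ zv]; rewrite inE.
move: nfz; rewrite /free -/A -/H Hh /= => /subsetPn[v vz vHT]; exists v => //.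
rewrite inE ffunE negb_or -/H; move: (vHT); rewrite in_setU negb_or => /andP[-> _].
by rewrite /x0 zeroedE in_setC vHT andbF.
Qed.

(** The tail state fills the tail, the head itself being marked by 1 so that it
    can be read off as the barren set of the ancestors of the support. *)
Definition param_state (a : param_index G) : states V :=
  let: existT H xT := a in
  [ffun v => (v \in val H) || (if insub v is Some u then xT u else false)].

Lemma supp_param (H : Defs.head G) (xT : config (tail G (val H))) :
  supp (param_state (existT _ H xT)) \subset val H :|: tail G (val H).
Proof.
apply/subsetP => v; rewrite inE ffunE inE; case: (_ \in _) => //=.
by case: insubP => // u ->.
Qed.

Lemma anset_param (H : Defs.head G) (xT : config (tail G (val H))) :
  anset G (param_state (existT _ H xT)) = an G (val H).
Proof.
apply: an_supp_head (valP H); first exact: supp_param.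
by apply/subsetP => v vH; rewrite inE ffunE vH.
Qed.

Lemma barren_param (H : Defs.head G) (xT : config (tail G (val H))) :
  barren G (anset G (param_state (existT _ H xT))) = val H.
Proof. by rewrite anset_param (barren_an_head (valP H)). Qed.

Lemma head_tail_disjoint H : H \in heads G -> [disjoint H & tail G H].
Proof.
move=> Hh; have [h hH] := set0Pn _ (head_neq0 Hh); have [_ ->] := head_tailE Hh hH.
by rewrite disjoints_subset setCD subsetUr.
Qed.

Lemma restrict_param (H : Defs.head G) (xT : config (tail G (val H))) :
  restrict (tail G (val H)) (param_state (existT _ H xT)) = xT.
Proof.
apply/ffunP => u; rewrite !ffunE valK.
by rewrite (disjointFl (head_tail_disjoint (valP H)) (valP u)).
Qed.

Lemma restrict_tailstate_param (H : Defs.head G) (xT : config (tail G (val H))) :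
  restrict (tail G (val H)) (tailstate G (param_state (existT _ H xT))) = xT.
Proof.
rewrite -[RHS]restrict_param; apply/ffunP => u; rewrite ffunE [RHS]ffunE.
rewrite tailstate_out // barren_param.
by rewrite (disjointFl (head_tail_disjoint (valP H)) (valP u)).
Qed.

Lemma param_state_inj : injective param_state.
Proof.
move=> [H xT] [H' xT'] E.
have EH : H = H' by apply: val_inj; rewrite /= -(barren_param xT) E barren_param.
subst H'; congr existT.
by rewrite -(restrict_param xT) E restrict_param.
Qed.

Lemma param_state_neq0 a : param_state a != zero_state V.
Proof.
case: a => H xT; have [h hH] := set0Pn _ (head_neq0 (valP H)).
by apply/eqP => /ffunP/(_ h); rewrite !ffunE hH.
Qed.

Lemma freeP z : reflect (exists a, z = param_state a) (free z).
Proof.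
apply: (iffP idP) => [/andP[Hh zHT]|[[H xT] ->]]; last first.
  by rewrite /free barren_param (valP H) supp_param.
pose H : Defs.head G := exist (fun H : {set V} => H \in heads G) _ Hh.
exists (existT _ H (restrict (tail G (val H)) z)); apply/ffunP => v.
rewrite ffunE; have [vH|vH] := boolP (v \in val H).
  by move: (subsetP (supp_barren z) _ vH); rewrite inE.
case: insubP => [u _ <-|vT]; first by rewrite ffunE.
apply/negbTE; apply: contra vT => zv; have := subsetP zHT v.
by rewrite inE => /(_ zv); rewrite in_setU (negbTE vH).
Qed.

End Coordinates.

(** * The chart *)

Section MomentCoordinates.
Local Open Scope classical_set_scope.
Variables (R : realType) (V : finType) (G : admg V).
Implicit Types (y : 'rV[R]_#|{: nonzero_state V}|) (p : 'rV[R]_#|{: states V}|)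
  (x z : states V).

Definition moment_mx : 'M[R]_#|{: states V}| :=
  \matrix_(j, i) (agree (anset G (enum_val i)) (tailstate G (enum_val i))
                        (enum_val j))%:R.

Lemma mulmx_moment p i : (p *m moment_mx) 0 i = moment G (mass p) (enum_val i).
Proof.
rewrite mxE /moment marginalE [RHS]big_mkcond [RHS](reindex_onto _ _ (in1W enum_rankK)) /=.
apply: eq_big => [j|j _]; first by rewrite enum_valK eqxx.
by rewrite mxE /mass enum_valK; case: ifP; rewrite ?mulr1 ?mulr0.
Qed.

(** A square matrix with trivial kernel: vectors with the same moments have the
    same marginals, in particular the same entries. *)
Lemma moment_mx_unit : moment_mx \in unitmx.
Proof.
rewrite -row_free_unit; apply: inj_row_free => p p0.
suff pz x : mass p x = 0 by apply/rowP => i; rewrite mxE -(pz (enum_val i)) /mass enum_valK.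
have anT : ancestral G [set: V] by apply/ancestralP => v w; rewrite !inE.
have z0 B u : marginal (fun=> 0 : R) B u = 0 by rewrite marginalE big1.
rewrite -(marginalT (mass p)) (moment_marginal (g := fun=> 0) anT) ?z0 // => z _.
rewrite -[z]enum_rankK -mulmx_moment p0 mxE /moment z0.
by [].
Qed.

Variable zeta : 'I_#|{: nonzero_state V}| -> nonzero_state V.
Variable zeta' : nonzero_state V -> 'I_#|{: nonzero_state V}|.
Hypotheses (zetaK : cancel zeta zeta') (zeta'K : cancel zeta' zeta).

(** The zero state stands for the total mass, which the coordinates omit. *)
Definition prescribed y z : R := if insub z is Some u then y 0 (zeta' u) else 1.

Definition law y : 'rV[R]_#|{: states V}| :=
  (\row_i prescribed y (enum_val i)) *m invmx moment_mx.

Definition moments p : 'rV[R]_#|{: nonzero_state V}| :=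
  \row_i moment G (mass p) (val (zeta i)).

Lemma moment_law y z : moment G (mass (law y)) z = prescribed y z.
Proof.
rewrite -[z]enum_rankK -mulmx_moment mulmxKV ?moment_mx_unit // mxE enum_rankK.
by [].
Qed.

Lemma moment_zero (f : states V -> R) : moment G f (zero_state V) = \sum_x f x.
Proof.
rewrite /moment anset0 marginalE; apply: eq_bigl => x.
by apply/agreeP => v; rewrite inE.
Qed.

Lemma prescribed0 y : prescribed y (zero_state V) = 1.
Proof. by rewrite /prescribed insubF ?eqxx. Qed.

Lemma prescribed_zeta y i : prescribed y (val (zeta i)) = y 0 i.
Proof. by rewrite /prescribed valK zetaK. Qed.

Lemma sum_law y : \sum_x mass (law y) x = 1.
Proof. by rewrite -moment_zero moment_law prescribed0. Qed.

Lemma momentsK p : \sum_x mass p x = 1 -> law (moments p) = p.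
Proof.
move=> p1; rewrite /law.
have -> : \row_i prescribed (moments p) (enum_val i) = p *m moment_mx.
  apply/rowP => i; rewrite mxE mulmx_moment; set z := enum_val i.
  have [->|z0] := eqVneq z (zero_state V); first by rewrite prescribed0 moment_zero.
  have -> : z = val (zeta (zeta' (exist _ z z0))) by rewrite zeta'K.
  by rewrite prescribed_zeta mxE.
by rewrite mulmxK ?moment_mx_unit.
Qed.

Lemma lawK y : moments (law y) = y.
Proof. by apply/rowP => i; rewrite mxE moment_law prescribed_zeta. Qed.

Lemma smooth_law U : open U -> smooth U law.
Proof.
move=> oU; apply: (smooth_comp oU openT) (smooth_mulmx _ openT) => //.
apply: smooth_row => // i k; rewrite /prescribed.
case: insubP => [u _ _|_]; first exact: scalarCk_coord.
exact: scalarCk_cst.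
Qed.

Lemma smooth_moments U : open U -> smooth U moments.
Proof.
move=> oU; apply: smooth_row => // i k.
have E p : moment G (mass p) (val (zeta i)) = (p *m moment_mx) 0 (enum_rank (val (zeta i))).
  by rewrite mulmx_moment enum_rankK.
apply: (scalarCk_ext oU (f := fun p => (p *m moment_mx) 0 (enum_rank (val (zeta i))))).
  by move=> p _; rewrite E.
exact: ((smoothP oU _).1 (smooth_mulmx moment_mx oU)).
Qed.

Lemma scalar_smooth_marginal U B x : open U ->
  scalar_smooth U (fun y => marginal (mass (law y)) B x).
Proof.
move=> oU k; apply: (scalarCk_ext oU) (scalarCk_sum oU
  (index_enum _) (P := agree B x) (fun z _ => (smoothP oU _).1 (smooth_law oU) _ k)) => y _.
by rewrite marginalE.
Qed.

Definition positive_laws : set 'rV[R]_#|{: nonzero_state V}| :=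
  [set y | forall x, 0 < mass (law y) x].

Lemma open_positive_laws : open positive_laws.
Proof.
rewrite -[positive_laws]setTI; apply: (open_positive openT (F := fun x y => mass (law y) x)) => x.
exact: ((smoothP openT _).1 (smooth_law openT)).
Qed.

Let A i := anset G (val (zeta i)).
Let x_ i := tailstate G (val (zeta i)).
Let rk i := depth G (val (zeta i)).

(** Dividing a moment by its scale gives a [barren_ratio]; subtracting the
    shift then compares it with its prediction, unless it is a parameter of the
    model. *)
Definition chart_scale i y := marginal (mass (law y)) (A i :\: barren G (A i)) (x_ i).

Definition chart_shift i y :=
  if free G (val (zeta i)) then 0 else predicted G (mass (law y)) (A i) (x_ i).

Definition chart y : 'rV[R]_#|{: nonzero_state V}| :=
  \row_i (y 0 i / chart_scale i y - chart_shift i y).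

Let D i : set 'rV[R]_#|{: nonzero_state V}| := setT `&`
  [set y | forall x, 0 < marginal (mass (law y)) (A i :\: barren G (A i)) x].

Lemma smooth_marginal_quotient i B x x' : scalar_smooth (D i) (fun y =>
  marginal (mass (law y)) B x /
  marginal (mass (law y)) (A i :\: barren G (A i)) x').
Proof.
have oD : open (D i).
  by apply: (open_positive openT (F := fun x y => marginal (mass (law y)) _ x)) => u;
    exact: scalar_smooth_marginal openT.
move=> k; apply: (scalarCkM oD); first exact: (scalar_smooth_marginal _ _ oD).
apply: (scalarCkV oD); first by move=> y [_ /(_ x') y0]; rewrite gt_eqF.
exact: (scalar_smooth_marginal _ _ oD).
Qed.

(** In the moment coordinates the chart is triangular with respect to the
    depth. *)
Lemma diffeomorphism_chart : exists W, diffeomorphism positive_laws W chart.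
Proof.
have oD i : open (D i).
  by apply: (open_positive openT (F := fun x y => marginal (mass (law y)) _ x)) => u;
    exact: scalar_smooth_marginal openT.
apply: (@diffeomorphism_triangular _ _ rk positive_laws D chart_shift chart_scale) => //.
- exact: open_positive_laws.
- by move=> i y y0; split=> // x; exact: marginal_gt0.
- move=> i k; rewrite /chart_shift; case: (free G _); first exact: scalarCk_cst.
  rewrite /predicted; case: (_ \in heads G); first exact: smooth_marginal_quotient.
  set H := barren G (A i); set E := chosen_district G (A i).
  apply: (scalarCk_ext (oD i)) (scalarCkM (oD i) (smooth_marginal_quotient i
    (A i :\: (H :&: E)) (x_ i) (x_ i) k)
    (smooth_marginal_quotient i (A i :\: (H :\: E)) (x_ i) (x_ i) k)) => y _.
  by rewrite mulf_div expr2.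
- by move=> i; exact: scalar_smooth_marginal.
- by move=> i y [_ /(_ (x_ i)) y0]; rewrite gt_eqF.
move=> i y y' yy'.
have z0 : val (zeta i) != zero_state V by exact: (valP (zeta i)).
have anA : ancestral G (A i) := anset_ancestral G _.
have mE z : (depth G z < rk i)%N ->
    moment G (mass (law y)) z = moment G (mass (law y')) z.
  rewrite !moment_law /prescribed; case: insubP => // u _ <- lt.
  by apply: yy'; rewrite /rk zeta'K.
have eqA : marginal (mass (law y)) (A i :\: barren G (A i)) =1
           marginal (mass (law y')) (A i :\: barren G (A i)).
  apply: (moment_marginal_proper (z := val (zeta i))) mE; first exact: ancestralD.
  by apply: properD1_barren => //; apply: barren_neq0 => //; exact: anset_neq0.
split.
- by move=> [_ y0]; split=> // x; rewrite -eqA.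
- rewrite /chart_shift; case: ifP => // /negbT nf.
  exact: predicted_lower.
by rewrite /chart_scale eqA.
Qed.

Lemma chartE y i : chart y 0 i =
  barren_ratio G (mass (law y)) (A i) (x_ i) - chart_shift i y.
Proof. by rewrite mxE /chart_scale -(prescribed_zeta y) -moment_law. Qed.

Lemma chart_model y : positive_laws y -> model R G (law y) <->
  forall i, ~~ free G (val (zeta i)) -> chart y 0 i = 0.
Proof.
move=> y0; split=> [[_ mk] i nf|ch].
  rewrite chartE /chart_shift (negbTE nf); apply/eqP; rewrite subr_eq0; apply/eqP.
  by apply: equations_of_global_markov => //; exact: (valP (zeta i)).
split; first by split; [exact: y0 | exact: sum_law].
apply: global_markov_of_equations => // z z0.
have -> : z = val (zeta (zeta' (exist _ z z0))) by rewrite zeta'K.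
set i := zeta' _; have [fz|nf] := boolP (free G (val (zeta i))).
  by rewrite predicted_free.
by have := ch i nf; rewrite chartE /chart_shift (negbTE nf) => /subr0_eq.
Qed.

Hypothesis zeta_param : forall (j : 'I_#|{: param_index G}|)
    (i : 'I_#|{: nonzero_state V}|),
  j = i :> nat -> val (zeta i) = param_state (enum_val j).
Hypothesis dN : (#|{: param_index G}| <= #|{: nonzero_state V}|)%N.

Lemma free_zeta i : free G (val (zeta i)) = (i < #|{: param_index G}|)%N.
Proof.
apply/freeP/idP => [[a za]|id].
  have E : val (zeta (widen_ord dN (enum_rank a))) = param_state a.
    by rewrite (zeta_param (j := enum_rank a)) ?enum_rankK.
  have -> : i = widen_ord dN (enum_rank a).
    by apply: (can_inj zetaK); apply: val_inj; rewrite za E.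
  exact: (ltn_ord (enum_rank a)).
by exists (enum_val (Ordinal id)); exact: zeta_param.
Qed.

Lemma chart_qmap y (i : 'I_#|{: nonzero_state V}|) (j : 'I_#|{: param_index G}|) :
  positive_laws y ->
  model R G (law y) -> j = i :> nat -> chart y 0 i = qmap R G (law y) 0 j.
Proof.
move=> y0 [_ mk] ji; rewrite chartE /chart_shift free_zeta -ji ltn_ord subr0.
rewrite mxE /A /x_ (zeta_param ji); case: (enum_val j) => H xT.
have Hh : barren G (anset G (param_state (existT _ H xT))) \in heads G.
  by rewrite barren_param (valP H).
rewrite markov_head //; last exact: anset_ancestral.
set x := tailstate _ _.
have -> : zero_config (val H) = restrict (val H) x.
  by apply/ffunP => u; rewrite ffunE [RHS]ffunE /x tailstate0 // barren_param (valP u).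
have ET := restrict_tailstate_param xT; rewrite -/x in ET.
rewrite -[in RHS]ET cprob_restrict.
by rewrite barren_param.
Qed.

End MomentCoordinates.

(** * Natural parameters and the parameterization *)

Section NaturalParameters.
Local Open Scope classical_set_scope.
Variables (R : realType) (V : finType).
Notation t := (saturated_statistic R V).
Implicit Types (theta : 'rV[R]_#|{: nonzero_state V}|) (p : 'rV[R]_#|{: states V}|).

Definition natural_parameter p : 'rV[R]_#|{: nonzero_state V}| :=
  \row_i ln (mass p (val (enum_val i)) / mass p (zero_state V)).

Let Z theta := \sum_x expR (dot theta (t x)).

Lemma partition_gt0 theta : 0 < Z theta.
Proof.
rewrite /Z (bigD1 (zero_state V)) //= ltr_pwDl ?expR_gt0 //.
by apply: sumr_ge0 => x _; exact: expR_ge0.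
Qed.

Lemma mass_exp_family theta x :
  mass (exp_family t theta) x = expR (dot theta (t x)) / Z theta.
Proof. by rewrite /mass mxE enum_rankK. Qed.

Lemma exp_familyK : cancel (exp_family t) natural_parameter.
Proof.
move=> theta; apply/rowP => i; rewrite mxE !mass_exp_family dot_saturated0 expR0.
rewrite dot_saturated enum_valK div1r invrK divfK ?expRK //.
by rewrite gt_eqF // partition_gt0.
Qed.

Lemma natural_parameterK p : pos_distribution p ->
  exp_family t (natural_parameter p) = p.
Proof.
move=> pp; have : range (exp_family t) p by rewrite saturated_familyE.
by case=> theta _ <-; rewrite exp_familyK.
Qed.

Lemma exp_family_pos theta : pos_distribution (exp_family t theta).
Proof.
have : range (exp_family t) (exp_family t theta) by exists theta.
by rewrite saturated_familyE.
Qed.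

Lemma smooth_exp_family : smooth setT (exp_family t).
Proof.
have oT : open [set: 'rV[R]_#|{: nonzero_state V}|] := openT.
have sE x : scalar_smooth setT (fun theta => expR (dot theta (t x))).
  move=> k; apply: (scalarCk_exp oT); apply: (scalarCk_sum oT) => i _.
  by apply: (scalarCkM oT); [exact: scalarCk_coord | exact: scalarCk_cst].
apply: smooth_row => [|i k]; first exact: oT.
apply: (scalarCkM oT) => //; first exact: sE.
apply: (scalarCkV oT) => [theta _|]; first by rewrite gt_eqF ?partition_gt0.
by apply: (scalarCk_sum oT) => x _; exact: sE.
Qed.

Definition positive : set 'rV[R]_#|{: states V}| := [set p | forall x, 0 < mass p x].

Lemma open_positive_mass : open positive.
Proof.
rewrite -[positive]setTI; apply: (open_positive openT (F := fun x p => mass p x)).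
by move=> x k; exact: (scalarCk_coord openT).
Qed.

Lemma smooth_natural_parameter : smooth positive natural_parameter.
Proof.
have oP := open_positive_mass; apply: smooth_row => // i k.
apply: (scalarCk_ln oP) => [p p0|]; first by rewrite divr_gt0.
apply: (scalarCkM oP); first exact: scalarCk_coord.
by apply: (scalarCkV oP) => [p p0|]; [rewrite gt_eqF | exact: scalarCk_coord].
Qed.

Variable G : admg V.

Lemma smooth_qmap : smooth positive (qmap R G).
Proof.
have oP := open_positive_mass; apply: smooth_row => // i k.
case: (enum_val i) => H xT; apply: (scalarCkM oP).
  by apply: (scalarCk_sum oP) => x _; exact: scalarCk_coord.
apply: (scalarCkV oP) => [p p0|]; last first.
  by apply: (scalarCk_sum oP) => x _; exact: scalarCk_coord.
rewrite gt_eqF // -(restrict_param xT).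
rewrite [X in 0 < X](_ : _ =
    marginal (mass p) (tail G (val H)) (param_state (existT _ H xT))).
  exact: marginal_gt0.
by rewrite marginalE /prob; apply: eq_bigl => x; rewrite ev_restrict.
Qed.

End NaturalParameters.

(** By the chain rule the Jacobian of a left inverse is a right inverse of the
    matrix ['J g y], which acts on rows. *)
Lemma rank_jacobian_left_inverse (R : realType) d N (Q : set 'rV[R]_d)
    (g : 'rV[R]_d -> 'rV[R]_N) (q : 'rV[R]_N -> 'rV[R]_d) y :
  open Q -> Q y -> (forall u, Q u -> q (g u) = u) ->
  differentiable g y -> differentiable q (g y) -> \rank ('J g y) = d.
Proof.
move=> oQ Qy qg dg dq; apply/eqP; apply/row_freeP; exists ('J q (g y)).
apply/row_matrixP => i; rewrite !rowE mulmx1 mulmxA; set v := delta_mx 0 i.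
have E : 'D_v (q \o g) y = v.
  rewrite -[RHS](derive_id y v); apply: near_eq_derive.
  by apply: (near_eq_on oQ) => // u; rewrite inE => /qg.
rewrite -[RHS]E deriveE; last exact: differentiable_comp.
rewrite diff_comp //= -[in RHS](deriveE v dg) -deriveE //.
by rewrite !deriveEjacobian.
Qed.

Lemma card_config (V : finType) (A : {set V}) : #|{: config A}| = (2 ^ #|A|)%N.
Proof. by rewrite card_ffun card_bool card_sig. Qed.

Lemma card_param_index (V : finType) (G : admg V) :
  #|{: param_index G}| = (\sum_(H in heads G) #|{: config (tail G H)}|)%N.
Proof.
rewrite card_tagged sumnE big_map big_enum /=.
by rewrite [RHS]big_sub; apply: eq_bigl.
Qed.

Theorem theorem6p5 (R : realType) (V : finType) (G : admg V) :
  [/\ smoothly_parameterized (model R G) (qmap R G),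
      curved_exponential_family (saturated_statistic R V)
        #|{: param_index G}| (model R G),
      #|{: param_index G}| = (\sum_(H in heads G) #|{: config (tail G H)}|)%N &
      (\sum_(H in heads G) #|{: config (tail G H)}| =
       \sum_(H in heads G) 2 ^ #|tail G H|)%N].
Proof.
set d := #|{: param_index G}|; set N := #|{: nonzero_state V}|.
pose phi (a : param_index G) : nonzero_state V :=
  exist (fun z => z != zero_state V) _ (param_state_neq0 a).
have phi_inj : injective phi by move=> a b /(congr1 val)/param_state_inj.
have [dN [zeta [zeta' zetaK zeta'K] zetaE]] := enum_extending phi_inj.
have zeta_param (j : 'I_d) (i : 'I_N) :
    j = i :> nat -> val (zeta i) = param_state (enum_val j).
  by move=> ji; rewrite (zetaE j).
pose ch : 'rV[R]_N -> 'rV[R]_N := chart G zeta zeta'.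
pose lw : 'rV[R]_N -> 'rV[R]_#|{: states V}| := law G zeta'.
pose U := positive_laws G zeta' : set 'rV[R]_N.
have [W dW] : exists W, diffeomorphism U W ch := diffeomorphism_chart R G zeta'K.
have [psi [spsi chK psiK]] := diffeomorphismE dW; have [oU oW _ sch _] := dW.
have mom_pos (p : 'rV[R]_#|{: states V}|) : pos_distribution p ->
    U (moments G zeta p) /\ lw (moments G zeta p) = p.
  by case=> p0 p1; rewrite /lw /U /positive_laws /= momentsK.
(* the points of the slice, whose first [d] coordinates are the parameters *)
pose emb (u : 'rV[R]_d) : 'rV[R]_N := u *m \matrix_(j, i) (j == i :> nat)%:R.
have embE u i : emb u 0 i = if insub (val i) is Some j then u 0 j else 0.
  rewrite mxE; case: insubP => [j _ ji|id].
    rewrite (bigD1 j) //= mxE ji eqxx mulr1 big1 ?addr0 // => k kj.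
    by rewrite mxE -ji val_eqE (negbTE kj) mulr0.
  rewrite big1 // => k _; rewrite mxE; case: eqP => [ki|]; rewrite ?mulr0 //.
  by case/negP: id; have := ltn_ord k; rewrite ki.
have emb_slice u : coord_slice d (emb u).
  by move=> i di; rewrite embE insubF // ltnNge di.
have sembT : smooth setT emb by exact: smooth_mulmx openT.
have chart_slice y : U y -> model R G (lw y) <-> coord_slice d (ch y).
  move=> Uy; rewrite (chart_model zetaK zeta'K Uy); split=> h i di; apply: h.
    by rewrite (free_zeta zetaK zeta_param dN) -leqNgt.
  by rewrite (free_zeta zetaK zeta_param dN) -leqNgt in di.
have slice_emb y : U y -> model R G (lw y) -> ch y = emb (qmap R G (lw y)).
  move=> Uy my; apply/rowP => i; rewrite embE; case: insubP => [j _ ji|id].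
    exact: (chart_qmap zetaK zeta_param dN Uy my).
  by apply: ((chart_slice y Uy).1 my); rewrite leqNgt.
have back u : W (emb u) -> model R G (lw (psi (emb u))) /\
    qmap R G (lw (psi (emb u))) = u.
  move=> Wu; have [Upsi chpsi] := psiK _ Wu.
  have mu : model R G (lw (psi (emb u))).
    by apply/chart_slice => //; rewrite chpsi.
  split=> //; apply/rowP => j; have := slice_emb _ Upsi mu.
  move=> /rowP/(_ (widen_ord dN j)); rewrite chpsi !embE.
  by case: insubP => [k _ /val_inj->|]; rewrite /= ?ltn_ord.
have forth p : model R G p -> W (emb (qmap R G p)) /\ lw (psi (emb (qmap R G p))) = p.
  move=> mp; have [Um lm] := mom_pos p mp.1; have [Wm psim] := chK _ Um.
  have := slice_emb _ Um; rewrite lm => /(_ mp) Em.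
  by rewrite -Em psim.
have QE : (qmap R G @` model R G = setT `&` emb @^-1` W)%classic.
  apply/seteqP; split=> [_ [p mp <-]|u [_ Wu]] /=.
    by split=> //; have [] := forth p mp.
  by have [mu qu] := back u Wu; exists (lw (psi (emb u))).
have oQ : open (qmap R G @` model R G)%classic.
  rewrite QE; apply: (open_preimage_in openT (f := emb) _ oW) => u Tu.
  exact: (smooth_continuous sembT Tu).
have QW u : (qmap R G @` model R G)%classic u -> W (emb u) by rewrite QE => -[].
split; last 1 first.
- by apply: eq_bigr => H _; rewrite card_config.
- split=> //.
  + split=> // p p'; rewrite !inE => mp mp' qq.
    by rewrite -[LHS](forth p mp).2 -[RHS](forth p' mp').2 qq.
  + move=> p [[p0 _] _]; exists (@positive R V), (qmap R G); split=> //.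
      exact: open_positive_mass.
    exact: smooth_qmap.
  have sg : smooth (qmap R G @` model R G)%classic (lw \o psi \o emb).
    apply: (smooth_comp oQ oW QW); first exact: smooth_subset (@subsetT _ _) sembT.
    by apply: (smooth_comp oW openT _ spsi) => //; exact: smooth_law openT.
  exists (lw \o psi \o emb); split=> // [y /QW/back //|y Qy].
  apply: (rank_jacobian_left_inverse (q := qmap R G) oQ Qy) => [u /QW/back[]//||].
    exact: (smooth_differentiable sg).
  have [[[p0 _] _] _] := back _ (QW _ Qy).
  exact: (smooth_differentiable (@smooth_qmap R V G)).
- split; [exact: saturated_minimal | | ].
    by rewrite saturated_familyE => p [].
  split=> // theta _.
  pose kap := moments G zeta \o exp_family (saturated_statistic R V).
  have dk : diffeomorphism setT U kap.
    apply: (@diffeomorphismI _ _ _ _ _ (@natural_parameter R V \o lw)) => //.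
    * exact: openT.
    * move=> th _ /=; have [Uth lth] := mom_pos _ (exp_family_pos th).
      by split=> //; rewrite lth exp_familyK.
    * move=> y Uy; have pl : pos_distribution (lw y).
        by split; [exact: Uy | exact: sum_law].
      by split=> //; rewrite /kap /= natural_parameterK // /lw lawK.
    * apply: (smooth_comp openT openT) => //; first exact: smooth_exp_family.
      exact: smooth_moments openT.
    apply: (smooth_comp oU (@open_positive_mass R V)) => //.
      exact: smooth_law.
    exact: smooth_natural_parameter.
  exists setT, (ch @` U)%classic, (ch \o kap); split; first by [].
    exact: diffeomorphism_comp dk dW _.
  have kapE th : lw (kap th) = exp_family (saturated_statistic R V) th.
    by have [] := mom_pos _ (exp_family_pos th).
  have [_ _ [kU _ kS] _ _] := dk.
  apply/seteqP; split=> [_ [th [_ mth] <-]|_ [[y Uy <-] sy]].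
    have Uth := kU th I; split; first by exists (kap th).
    by apply/chart_slice; rewrite ?kapE.
  have [th _ thy] := kS y Uy; exists th; last by rewrite /= thy.
  by split=> //=; rewrite -kapE thy; apply/chart_slice.
exact: card_param_index.
Qed.
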